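(* Let $Q_0\subset\mathbb{R}^n$ be a cube, $1<p<\infty$, $w\in A_\infty^d(Q_0)$ with constants $C_w,\delta_w$, and $f\in L^1(Q_0)$. Then $$\int_{Q_0}|f(x)-f_{Q_0}|^p\,w(x)\,dx\le C\int_{Q_0}\left(M^{d,\sharp}_{Q_0}f(x)\right)^p w(x)\,dx,$$ where $C=C(n,p,C_w,\delta_w)>0$.
   Context: A cube in $\mathbb{R}^n$ is a half-open set $[a_1,b_1)\times\cdots\times[a_n,b_n)$ with $b_1-a_1=\dots=b_n-a_n>0$. $\mathcal{D}(Q_0)$ is the collection of dyadic subcubes of $Q_0$: $Q_0$ itself together with all cubes obtained by repeatedly bisecting each edge. A weight in $Q_0$ is a locally integrable function $w$ on $Q_0$ with $w>0$ almost everywhere; $w(E)=\int_Ew(x)\,dx$. A weight $w$ in $Q_0$ belongs to $A_\infty^d(Q_0)$ with constants $C_w,\delta_w\in(0,\infty)$ if for all $Q\in\mathcal{D}(Q_0)$ and all measurable $E\subset Q$, $\frac{w(E)}{w(Q)}\le C_w\left(\frac{|E|}{|Q|}\right)^{\delta_w}$ (in particular $0<w(Q)<\infty$ is implicit). $f_E=\frac1{|E|}\int_Ef(x)\,dx$. The dyadic sharp maximal function is $$M^{d,\sharp}_{Q_0}f(x)=\sup_{Q\in\mathcal{D}(Q_0),\,Q\ni x}\frac{1}{|Q|}\int_Q|f(y)-f_Q|\,dy,\qquad x\in Q_0.$$ *)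

(* Defs.v *)
From HB Require Import structures.
From mathcomp Require Import all_boot all_order all_algebra.
From mathcomp Require Import all_classical all_reals all_analysis.

Set Implicit Arguments.
Unset Strict Implicit.
Unset Printing Implicit Defensive.
Import Order.TTheory GRing.Theory Num.Theory.
Import numFieldNormedType.Exports.

Local Open Scope classical_set_scope.
Local Open Scope ring_scope.

(* MathComp-Analysis has no Lebesgue measure on R^n: it is built here as the
   Caratheodory restriction of the usual outer measure (infimum of the total
   volume of countable covers by half-open boxes), so that measurability below
   is Lebesgue measurability.  Points of R^n are row vectors; dimensions are
   written n.+1 since only n >= 1 is meaningful. *)
Section lebesgue_outer.
Context {R : realType} {n : nat}.
Local Notation Rn := 'rV[R]_n.+1.

Definition box (a b : Rn) : set Rn :=
  [set x | forall i, a ord0 i <= x ord0 i < b ord0 i].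

(* The truncation at 0 gives volume 0 to a box that is empty because
   b ord0 i < a ord0 i for some i. *)
Definition box_vol (a b : Rn) : R :=
  \prod_i Num.max (b ord0 i - a ord0 i) 0.

Local Open Scope ereal_scope.

Definition box_cover (A : set Rn) : set (nat -> Rn * Rn) :=
  [set c | A `<=` \bigcup_k box (c k).1 (c k).2].

Definition lebesgue_outer (A : set Rn) : \bar R :=
  ereal_inf [set \sum_(k <oo) (box_vol (c k).1 (c k).2)%:E | c in box_cover A].

Lemma box_vol_ge0 (a b : Rn) : 0 <= (box_vol a b)%:E.
Proof. by rewrite lee_fin prodr_ge0// => i _; rewrite le_max lexx orbT. Qed.

Lemma lebesgue_outer_ge0 A : 0 <= lebesgue_outer A.
Proof.
apply: le_ereal_inf_tmp => x [c _ <-{x}].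
by apply: nneseries_ge0 => k _ _; exact: box_vol_ge0.
Qed.

Lemma le_lebesgue_outer :
  {homo lebesgue_outer : A B / A `<=` B >-> A <= B}.
Proof.
move=> A B AB; apply/ereal_inf_le_tmp => x [c cB <-{x}]; exists c => //.
exact: subset_trans AB cB.
Qed.

Lemma lebesgue_outer0 : lebesgue_outer set0 = 0.
Proof.
apply/eqP; rewrite eq_le lebesgue_outer_ge0 andbT.
apply: ereal_inf_lbound; exists (fun=> (0, 0)%R) => //=.
apply: eseries0 => k _ _; congr EFin.
by apply/eqP/prodf_eq0; exists ord0; rewrite // subrr maxxx.
Qed.

Lemma lebesgue_outer_sigma_subadditive : sigma_subadditive lebesgue_outer.
Proof.
move=> A; have [[i ioo]|] := pselect (exists i, lebesgue_outer (A i) = +oo).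
  rewrite (eseries_pinfty _ _ ioo) ?leey// => k _.
  by rewrite -ltNye (lt_le_trans _ (lebesgue_outer_ge0 _)).
rewrite -forallNE => Aoo.
pose v (c : Rn * Rn) : \bar R := (box_vol c.1 c.2)%:E.
have v_ge0 c : 0 <= v c by exact: box_vol_ge0.
suff add2e (e : {posnum R}) : lebesgue_outer (\bigcup_k A k) <=
    \sum_(i <oo) lebesgue_outer (A i) + e%:num%:E.
  by apply/lee_addgt0Pr => _/posnumP[].
rewrite (le_trans _ (epsilon_trick _ _ _))//; last first.
  by move=> k; exact: lebesgue_outer_ge0.
pose P k (c : nat -> Rn * Rn) := box_cover (A k) c /\
  \sum_(j <oo) v (c j) <= lebesgue_outer (A k) + (e%:num / (2 ^ k.+1)%:R)%:E.
have [G PG] : {G : nat -> nat -> Rn * Rn & forall k, P k (G k)}.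
  apply: (@choice _ _ P) => k; rewrite /P /lebesgue_outer.
  set S := (X in ereal_inf X); move infS : (ereal_inf S) => iS.
  case: iS infS => [r Sr|Soo|Soo].
  - have en1 : (0 < e%:num / (2 ^ k.+1)%:R)%R by [].
    have /(lb_ereal_inf_adherent en1) : ereal_inf S \is a fin_num by rewrite Sr.
    by move=> [x [c Ac <-] xS]; exists c; split => //; rewrite -Sr; exact/ltW.
  - by have := Aoo k; rewrite /lebesgue_outer Soo.
  - by have := lebesgue_outer_ge0 (A k); rewrite /lebesgue_outer -/S Soo.
have vG_ge0 x : 0 <= (v \o uncurry G) x by exact: v_ge0.
apply: (@le_trans _ _ (\esum_(i in setT) (v \o uncurry G) i)).
  apply: ereal_inf_lbound => /=.
  have /card_esym/ppcard_eqP[f] := card_nat2.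
  exists (uncurry G \o f).
    move=> t [i _ Ait]; have [j _ Gijt] := (PG i).1 _ Ait.
    by exists (f^-1%FUN (i, j)) => //=; rewrite invK ?inE.
  rewrite -(esum_pred_image (v \o uncurry G) _ xpredT) ?[fun=> _]set_true//.
  by rewrite image_eq.
rewrite (_ : esum _ _ = \sum_(i <oo) \sum_(j <oo) v (G i j)); last first.
  pose J : nat -> set (nat * nat) := fun i => [set (i, j) | j in setT].
  rewrite (_ : setT = \bigcup_k J k); last first.
    by rewrite predeqE => -[a b]; split => // _; exists a => //; exists b.
  rewrite esum_bigcupT /=; last 2 first.
  - apply/trivIsetP => i j _ _ ij.
    rewrite predeqE => -[k m] /=; split => //= -[] [_] _ [<-{k} _].
    by move=> [m' _] [] /esym/eqP; rewrite (negbTE ij).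
  - by move=> /= [k m]; exact: v_ge0.
  rewrite -(image_id [set: nat]) -fun_true esum_pred_image//; last first.
    by move=> k _; exact: esum_ge0.
  apply: eq_eseriesr => /= j _.
  rewrite -(esum_pred_image (v \o uncurry G) (pair j) predT)//=; last first.
    by move=> ? ? _ _; exact: (@can_inj _ _ _ snd).
  by congr esum; rewrite predeqE => -[a b]; split; move=> [i _ <-]; exists i.
by apply: lee_nneseries => k *; [exact: nneseries_ge0|exact: (PG k).2].
Qed.

HB.instance Definition _ := isOuterMeasure.Build R Rn lebesgue_outer
  lebesgue_outer0 lebesgue_outer_ge0 le_lebesgue_outer
  lebesgue_outer_sigma_subadditive.

Definition lebesgue_outer_measure : {outer_measure set Rn -> \bar R} :=
  lebesgue_outer.

End lebesgue_outer.

(* 'rV[R]_n.+1 with the sigma-algebra of Lebesgue measurable sets *)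
Definition Rspace (R : realType) (n : nat) :
    measurableType (caratheodory_display (@lebesgue_outer_measure R n)) :=
  caratheodory_type (@lebesgue_outer_measure R n).

Definition leb {R : realType} {n : nat} : {measure set (Rspace R n) -> \bar R} :=
  (@lebesgue_outer_measure R n : set (Rspace R n) -> \bar R).

Section dyadic.
Context {R : realType} {n : nat}.
Local Notation Rn := (Rspace R n).
Implicit Types (Q E : set Rn) (f w : Rn -> R).

Definition cube (a : 'rV[R]_n.+1) (l : R) : set Rn := box a (a + const_mx l).

Definition is_cube Q := exists (a : 'rV[R]_n.+1) (l : R), 0 < l /\ Q = cube a l.

(* The vector e selects, in each coordinate, the lower or the upper half of
   the bisected edge. *)
Inductive dyadic (Q0 : set Rn) : set Rn -> Prop :=
| dyadic_self : dyadic Q0 Q0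
| dyadic_bisect (a : 'rV[R]_n.+1) (l : R) (e : 'I_n.+1 -> bool) :
    0 < l -> dyadic Q0 (cube a l) ->
    dyadic Q0 (cube (a + \row_i (if e i then l / 2 else 0)) (l / 2)).

Definition weight (Q0 : set Rn) w :=
  [/\ measurable_fun Q0 w,
      forall K : set 'rV[R]_n.+1, compact K -> K `<=` Q0 ->
        leb.-integrable K (EFin \o w) &
      {ae leb, forall x, Q0 x -> 0 < w x}].

Definition weight_of w E : \bar R := (\int[leb]_(x in E) (w x)%:E)%E.

Definition Ainfty_dyadic (Q0 : set Rn) w (Cw dw : R) :=
  [/\ weight Q0 w, 0 < Cw, 0 < dw &
    forall Q, dyadic Q0 Q ->
      (0 < weight_of w Q < +oo)%E /\
      forall E, measurable E -> E `<=` Q ->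
        (weight_of w E / weight_of w Q <= Cw%:E * (leb E / leb Q) `^ dw)%E].

Definition avg f E : R := (fine (leb E))^-1 * \int[leb]_(x in E) f x.

Definition dyadic_sharp_maximal (Q0 : set Rn) f (x : Rn) : \bar R :=
  ereal_sup [set ((leb Q)^-1 * \int[leb]_(y in Q) `|f y - avg f Q|%:E)%E
            | Q in [set Q | dyadic Q0 Q /\ Q x]].

End dyadic.

(* Main.v *)
Require Import Defs.
From mathcomp Require Import all_boot all_order all_algebra.
From mathcomp Require Import all_classical all_reals all_analysis.
From mathcomp Require Import measurable_realfun ring lra.
Import Order.TTheory GRing.Theory Num.Theory.
Import numFieldNormedType.Exports.
Local Open Scope classical_set_scope.
Local Open Scope ring_scope.

(* The constant c = f_{Q0} is approximated by the dyadic averages f_Q.  Put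
   N(x) = sup |f_Q - c| over the dyadic Q containing x; then |f - c| <= N almost
   everywhere, and N is compared with the sharp maximal function M by the
   good-lambda inequality
     w(N > 2 lam, M <= g lam) <= C_w (2 g)^delta w(N > lam).
   If Q is a first cube with |f_Q - c| > lam and it meets {M <= g lam}, then
   |f_Q - c| <= 3/2 lam, so N > 2 lam on Q forces the maximal function of f - f_Q
   over Q above lam / 2; the weak type (1,1) inequality bounds that set by
   2 g |Q|, and the A_infty condition turns this into w-measure.
   Everything is done with the finitely many generations of cubes up to j, by
   induction on j: a cube is the disjoint union of its children, hence no
   stopping families are needed, N is bounded, and the absorption of the
   good-lambda inequality is legitimate.  Monotone convergence in j concludes. *)

(** * Lebesgue measure of boxes and cubes *)

Section boxes.
Context {R : realType} {n : nat}.
Local Notation Rn := 'rV[R]_n.+1.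
Implicit Types (a b c v x y : Rn) (A : set Rn).

Definition set_coord a (i : 'I_n.+1) (t : R) : Rn :=
  \row_j (if j == i then t else a ord0 j).

(** Cutting along the hyperplane x_i = t changes only the i-th factor of the product. The
    truncations by [Num.min] and [Num.max] keep the identity valid when [t] lies outside the edge or
    the box is empty. *)
Lemma box_vol_split a b i t :
  box_vol a b = box_vol a (set_coord b i (Num.min (b ord0 i) t)) +
                box_vol (set_coord a i (Num.max (a ord0 i) t)) b.
Proof.
rewrite /box_vol [LHS](bigD1 i)//= [X in _ = X + _](bigD1 i)//=.
rewrite [X in _ = _ + X](bigD1 i)//= !mxE eqxx.
rewrite [X in _ = _ + _ * X](eq_bigr (fun j => Num.max (b ord0 j - a ord0 j) 0)); last first.
  by move=> j /negPf ji; rewrite !mxE ji.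
rewrite [X in _ = _ * X + _](eq_bigr (fun j => Num.max (b ord0 j - a ord0 j) 0)); last first.
  by move=> j /negPf ji; rewrite !mxE ji.
rewrite -mulrDl; congr (_ * _).
move: (a ord0 i) (b ord0 i) => u v.
by case: (leP v t) => ?; case: (leP u t) => ?;
  do !case: leP => ?; lra.
Qed.

(** Caratheodory's criterion: the hyperplane cuts every cover of [X] into covers of the two parts of
    [X], and [box_vol_split] preserves the total volume. *)
Lemma measurable_halfspace (i : 'I_n.+1) (t : R) :
  measurable ([set x : Rn | x ord0 i < t] : set (Rspace R n)).
Proof.
apply: le_caratheodory_measurable => X.
apply: le_ereal_inf_tmp => _ [c cX <-].
pose v (c : Rn * Rn) := (box_vol c.1 c.2)%:E.
pose c1 k := ((c k).1, set_coord (c k).2 i (Num.min ((c k).2 ord0 i) t)).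
pose c2 k := (set_coord (c k).1 i (Num.max ((c k).1 ord0 i) t), (c k).2).
rewrite (eq_eseriesr (g := fun k => (v (c1 k) + v (c2 k))%E)); last first.
  by move=> k _; rewrite /v -EFinD -box_vol_split.
rewrite nneseriesD; [|by move=> *; exact: box_vol_ge0..].
apply: leeD.
- apply: ereal_inf_lbound; exists c1 => // x [Xx xt].
  have [k _ ck] := cX x Xx; exists k => // j; rewrite !mxE.
  have /andP[-> jb] := ck j; case: eqP => [ji|]//=.
  by rewrite lt_min -ji jb ji.
- apply: ereal_inf_lbound; exists c2 => // x [Xx /negP]; rewrite -leNgt => xt.
  have [k _ ck] := cX x Xx; exists k => // j; rewrite !mxE.
  have /andP[aj ->] := ck j; case: eqP => [ji|]//=; rewrite ?aj// andbT.
  by rewrite ge_max -ji aj ji.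
Qed.

Lemma measurable_box a b : measurable (box a b : set (Rspace R n)).
Proof.
rewrite (_ : box a b = \bigcap_(i in [set: 'I_n.+1])
   (~` [set x : Rn | x ord0 i < a ord0 i] `&` [set x : Rn | x ord0 i < b ord0 i])).
  apply: fin_bigcap_measurable => // i _.
  by apply: measurableI; [apply: measurableC|]; exact: measurable_halfspace.
apply/seteqP; split => x /= xab i; first by move=> _; have /andP[ai bi] := xab i; split => //; apply/negP; rewrite -leNgt.
by have [/negP] := xab i I; rewrite -leNgt => -> ->.
Qed.

Lemma leb_box_le a b : (leb (box a b : set (Rspace R n)) <= (box_vol a b)%:E)%E.
Proof.
apply: ereal_inf_lbound; exists (fun k => if k == 0%N then (a, b) else (0, 0)).
  by move=> x xab; exists 0%N.
rewrite (nneseries_split _ 1); last by move=> *; exact: box_vol_ge0.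
rewrite eseries0 ?adde0 ?big_nat1// => -[//|k] _ _ /=; congr EFin.
by apply/eqP/prodf_eq0; exists ord0; rewrite // subrr maxxx.
Qed.

Lemma leb_translate_le A v :
  (leb ([set (x + v)%R | x in A] : set (Rspace R n)) <= leb (A : set (Rspace R n)))%E.
Proof.
apply: le_ereal_inf_tmp => _ [c cA <-].
apply: ereal_inf_lbound; exists (fun k => ((c k).1 + v, (c k).2 + v)).
  move=> _ [x Ax <-]; have [k _ ck] := cA x Ax; exists k => // i.
  by rewrite !mxE lerD2r ltrD2r; exact: ck.
apply: eq_eseriesr => k _; congr EFin; apply: eq_bigr => i _.
by rewrite !mxE opprD addrACA subrr addr0.
Qed.

Lemma cube_translate a l v : cube (a + v) l = [set x + v | x in cube a l].
Proof.
apply/seteqP; split => [x xav|_ [x xa <-]].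
  exists (x - v); last by rewrite subrK.
  by move=> i; have := xav i; rewrite !mxE; lra.
by move=> i; have := xa i; rewrite !mxE; lra.
Qed.

Lemma leb_cube_translate a v l :
  leb (cube (a + v) l : set (Rspace R n)) = leb (cube a l : set (Rspace R n)).
Proof.
have le b w : (leb (cube (b + w) l : set (Rspace R n)) <= leb (cube b l : set (Rspace R n)))%E.
  by rewrite cube_translate; exact: leb_translate_le.
by apply/eqP; rewrite eq_le le -{1}[a](addrK v) le.
Qed.

Lemma leb_cube_lt_pinfty a l : (leb (cube a l : set (Rspace R n)) < +oo)%E.
Proof. by rewrite (le_lt_trans (leb_box_le _ _)) ?ltry. Qed.

(** The volume is a finite product of continuous functions of [t], hence continuous at t = 0. *)
Lemma box_vol_enlarge a b (e : R) : 0 < e ->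
  exists t : R, 0 < t /\ box_vol (a - const_mx t) b <= box_vol a b + e.
Proof.
move=> e0.
have cvgv : box_vol (a - const_mx t) b @[t --> (0:R)] --> box_vol a b.
  apply: cvg_big => [|i _]; first exact: mul_continuous.
  rewrite (_ : (fun t : R => _) = fun t => Num.max (b ord0 i - a ord0 i + t) 0); last first.
    by apply/funext => t; rewrite !mxE opprB addrA addrAC.
  rewrite -[in X in _ --> X](addr0 (b ord0 i - a ord0 i)).
  apply: (@continuous_max R R (fun t => b ord0 i - a ord0 i + t) (cst 0) 0);
    last exact: cvg_cst.
  by apply: cvgD; [exact: cvg_cst|exact: cvg_id].
move/cvgr_dist_lt : cvgv => /(_ _ e0) /nbhs_ballP[d /= d0 dv].
exists (d / 2); split; first by rewrite divr_gt0.
have := dv (d / 2); rewrite /ball/= sub0r normrN gtr0_norm ?divr_gt0//.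
move=> /(_ _)/wrap[]; first by rewrite ltr_pdivrMr// ltr_pMr// ltr1n.
by rewrite ltr_norml => /andP[+ _]; lra.
Qed.

(* Half-open boxes are enlarged downwards only: a point x of [a, b) already has
   room below b. *)
Lemma leb_outer_regular (E : set (Rspace R n)) (e : R) : measurable E ->
  (leb E < +oo)%E -> 0 < e ->
  exists U : set (Rspace R n), [/\ measurable U, E `<=` U, (leb (U `\` E) <= e%:E)%E &
    forall x : Rn, E x -> exists d : R, 0 < d /\
      forall y : Rn, (forall i, `|y ord0 i - x ord0 i| < d) -> U y].
Proof.
move=> mE Efin e0.
have e20 : 0 < e / 2 by rewrite divr_gt0.
have Efn : leb E \is a fin_num by rewrite ge0_fin_numE.
(* Half of [e] pays for a nearly optimal cover of [E]; the other half is spread geometrically over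
   the enlargements of its boxes. *)
have [_ [c cE <-] cEe] := lb_ereal_inf_adherent e20 (Efn : ereal_inf _ \is a fin_num).
have ek0 k : 0 < e / 2 / (2 ^ k.+1)%:R by rewrite divr_gt0// ltr0n expn_gt0.
have /choice[t tP] := fun k => box_vol_enlarge (c k).1 (c k).2 _ (ek0 k).
pose B k := box ((c k).1 - const_mx (t k)) (c k).2.
have mB k : measurable (B k : set (Rspace R n)) by exact: measurable_box.
exists (\bigcup_k B k); split.
- exact: bigcup_measurable.
- move=> x /cE[k _ ck]; exists k => // i; have [tk _] := tP k.
  by have := ck i; rewrite !mxE; lra.
- have mU : measurable (\bigcup_k B k : set (Rspace R n)) by exact: bigcup_measurable.
  have Ule : (leb (\bigcup_k B k : set (Rspace R n)) <= leb E + e%:E)%E.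
    apply: (le_trans (outer_measure_sigma_subadditive lebesgue_outer_measure B)).
    apply: (@le_trans _ _ (\sum_(k <oo) ((box_vol (c k).1 (c k).2)%:E +
        (e / 2 / (2 ^ k.+1)%:R)%:E))%E).
      apply: lee_nneseries => [k _ _|k _]; first exact: outer_measure_ge0.
      apply: (le_trans (leb_box_le _ _)).
      by rewrite -EFinD lee_fin; exact: (tP k).2.
    apply: (le_trans (epsilon_trick _ _ _)) => [k||]; first exact: box_vol_ge0.
      exact: ltW.
    apply: (@le_trans _ _ ((leb E + (e / 2)%:E) + (e / 2)%:E)%E).
      by apply: leeD => //; exact: ltW.
    by rewrite -addeA -EFinD -splitr.
  rewrite measureD//; last by rewrite (le_lt_trans Ule)// lte_add_pinfty// ltry.
  rewrite (_ : _ `&` E = E); first by rewrite leeBlDl.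
  apply/setIidr => x /cE[k _ ck]; exists k => // i; have [tk _] := tP k.
  by have := ck i; rewrite !mxE; lra.
- move=> x /cE[k _ ck]; have [tk _] := tP k.
  (* The term [t k] is the room gained below [x] by the enlargement; the other terms are the room
     above [x] in each coordinate. *)
  pose m := \big[Num.min/t k]_i ((c k).2 ord0 i - x ord0 i).
  have m0 : 0 < m.
    apply/lt_bigmin => // i _; by rewrite subr_gt0; have /andP[] := ck i.
  exists m; split => // y yx; exists k => // i.
  have := yx i; rewrite ltr_norml !mxE => /andP[yl yr].
  have mt : m <= t k by exact: bigmin_le_id.
  have mi : m <= (c k).2 ord0 i - x ord0 i by exact: bigmin_le.
  by have /andP[] := ck i; lra.
Qed.
End boxes.

(** * Maxima over a finite dyadic tree *)

Section tree.
Context {R : realType} {n : nat}.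
Local Notation Rn := 'rV[R]_n.+1.
Local Notation X := (Rspace R n).
Local Notation dirs := {ffun 'I_n.+1 -> bool}.
Implicit Types (a x y : Rn) (l : R) (e : dirs) (F G : set X -> R).

(** The directions form a finite type, so that sums over the children of a cube make sense; [dyadic]
    uses plain functions instead. *)
Definition child a l (e : dirs) : Rn := a + \row_i (if e i then l / 2 else 0).

(** For [x] in the cube, this is the corner of the unique child containing [x]; elsewhere it is
    still the corner of some child. *)
Definition kid a l x : Rn := child a l [ffun i => a ord0 i + l / 2 <= x ord0 i].

(* The maximum of F over the cubes of the generations 0, ..., j of cube a l that
   contain x. *)
Fixpoint tmax F j a l x : R :=
  if j is j'.+1 then Num.max (F (cube a l)) (tmax F j' (kid a l x) (l / 2) x)
  else F (cube a l).

Lemma kid_child a l e x : cube (child a l e) (l / 2) x -> kid a l x = child a l e.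
Proof.
move=> xe; congr child; apply/ffunP => i; rewrite ffunE.
have := xe i; rewrite !mxE; case: (e i) => /andP[? ?]; first exact/idP.
by apply/negbTE; rewrite -ltNge; lra.
Qed.

Lemma mem_kid a l x : cube a l x -> cube (kid a l x) (l / 2) x.
Proof.
move=> xa i; have := xa i; rewrite !mxE ffunE; case: ifPn => [|]; first lra.
by rewrite -ltNge => ?; rewrite addr0; lra.
Qed.

Lemma child_sub a l e : 0 < l -> cube (child a l e) (l / 2) `<=` cube a l.
Proof. by move=> l0 x xe i; have := xe i; rewrite !mxE; case: (e i); lra. Qed.

Lemma measurable_cube a l : measurable (cube a l : set X).
Proof. exact: measurable_box. Qed.
Hint Resolve measurable_cube : core.

(** The extra set [A] lets this decomposition, and the additivity lemmas drawn from it, apply to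
    level sets inside a cube. *)
Lemma cube_children (A : set X) a l : 0 < l ->
  A `&` cube a l =
  \big[setU/set0]_(e <- index_enum dirs) (A `&` cube (child a l e) (l / 2)).
Proof.
move=> l0; apply/seteqP; split => x.
  move=> [Ax xa]; rewrite -bigcup_seq.
  exists [ffun i => a ord0 i + l / 2 <= x ord0 i]; first exact: mem_index_enum.
  by split => //; exact: mem_kid.
rewrite -bigcup_seq => -[e _ [Ax xe]]; split=> //; exact: child_sub xe.
Qed.

Lemma trivIset_children (A : set X) (D : set dirs) a l : 0 < l ->
  trivIset D (fun e => A `&` cube (child a l e) (l / 2)).
Proof.
move=> l0 e e' _ _ [x [[_ xe] [_ xe']]].
have := kid_child _ _ _ _ xe; rewrite (kid_child _ _ _ _ xe') => /rowP ee.
apply/ffunP => i; have := ee i; rewrite !mxE => /addrI.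
by case: (e i) (e' i) => -[]//; lra.
Qed.

Lemma measurable_child (A : set X) a l e : 0 < l -> measurable (A `&` cube a l) ->
  measurable (A `&` cube (child a l e) (l / 2) : set X).
Proof.
move=> l0 mA.
rewrite (_ : _ `&` _ = (A `&` cube a l) `&` cube (child a l e) (l / 2)).
  exact: measurableI.
rewrite -setIA; congr (_ `&` _); apply/esym/setIidr; exact: child_sub.
Qed.

Lemma ge0_integral_children (A : set X) a l (h : X -> \bar R) : 0 < l ->
  measurable (A `&` cube a l) -> measurable_fun (cube a l : set X) h ->
  (forall x, cube a l x -> (0 <= h x)%E) ->
  (\int[leb]_(x in A `&` cube a l) h x =
   \sum_(e : dirs) \int[leb]_(x in A `&` cube (child a l e) (l / 2)) h x)%E.
Proof.
move=> l0 mA mh h0; rewrite cube_children// ge0_integral_bigsetU//.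
- by move=> e; exact: measurable_child.
- exact: index_enum_uniq.
- exact: trivIset_children.
- rewrite -cube_children//; apply: measurable_funS mh => //.
- by rewrite -cube_children// => x [_]; exact: h0.
Qed.

Lemma integral_children (A : set X) a l (h : X -> R) : 0 < l ->
  measurable (A `&` cube a l) -> measurable_fun (cube a l : set X) h ->
  (\int[leb]_(x in A `&` cube a l) (h x)%:E =
   \sum_(e : dirs) \int[leb]_(x in A `&` cube (child a l e) (l / 2)) (h x)%:E)%E.
Proof.
move=> l0 mA mh; rewrite cube_children// integral_bigsetU_EFin//.
- by move=> e; exact: measurable_child.
- exact: index_enum_uniq.
- exact: trivIset_children.
- by rewrite -cube_children//; apply/measurable_EFinP; apply: measurable_funS mh.
Qed.

Lemma leb_children (A : set X) a l : 0 < l -> measurable (A `&` cube a l) ->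
  (leb (A `&` cube a l) =
   \sum_(e : dirs) leb (A `&` cube (child a l e) (l / 2)))%E.
Proof.
move=> l0 mA; have := @ge0_integral_children A a l (cst 1%E) l0 mA.
rewrite integral_cst ?mul1e//.
move=> -> //; apply: eq_bigr => e _.
by rewrite integral_cst ?mul1e//; exact: measurable_child.
Qed.

Lemma leb_cubeE a l : leb (cube a l : set X) = (fine (leb (cube a l : set X)))%:E.
Proof. by rewrite fineK// ge0_fin_numE// leb_cube_lt_pinfty. Qed.

(** The children partition the cube and are translates of one another, so they share its measure
    equally. *)
Lemma leb_child a l e : 0 < l -> fine (leb (cube a l : set X)) =
  #|dirs|%:R * fine (leb (cube (child a l e) (l / 2) : set X)).
Proof.
move=> l0; have := leb_children [set: X] a _ l0.
rewrite (_ : _ `&` cube a l = cube a l); last exact: setTI.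
move=> /(_ (measurable_cube a l)).
move=> ->.
rewrite (eq_bigr (fun=> (fine (leb (cube (child a l e) (l / 2) : set X)))%:E)).
  by rewrite sumEFin /= sumr_const mulr_natl.
move=> e' _; rewrite -leb_cubeE (_ : _ `&` _ = cube (child a l e') (l / 2)).
  by rewrite !leb_cube_translate.
exact: setTI.
Qed.

Lemma vol_children (A : set X) a l : 0 < l -> measurable (A `&` cube a l) ->
  fine (leb (A `&` cube a l)) =
  \sum_(e : dirs) fine (leb (A `&` cube (child a l e) (l / 2))).
Proof.
move=> l0 mA; rewrite leb_children// sum_fine// => e _.
rewrite ge0_fin_numE//; apply: (le_lt_trans _ (leb_cube_lt_pinfty (child a l e) (l / 2))).
apply: (le_outer_measure lebesgue_outer_measure); exact: subIsetr.
Qed.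

Lemma Rintegral_children (A : set X) a l (h : X -> R) : 0 < l ->
  measurable (A `&` cube a l) -> leb.-integrable (cube a l : set X) (EFin \o h) ->
  \int[leb]_(x in A `&` cube a l) h x =
   \sum_(e : dirs) \int[leb]_(x in A `&` cube (child a l e) (l / 2)) h x.
Proof.
move=> l0 mA Ih; rewrite /Rintegral integral_children//; last first.
  by apply/measurable_EFinP; exact: measurable_int Ih.
rewrite sum_fine// => e _; apply: integrable_fin_num; first exact: measurable_child.
apply: integrableS Ih => //; first exact: measurable_child.
by move=> x [_]; exact: child_sub.
Qed.

Lemma tmax_child F j a l e x : cube (child a l e) (l / 2) x ->
  tmax F j.+1 a l x = Num.max (F (cube a l)) (tmax F j (child a l e) (l / 2) x).
Proof. by move=> xe; rewrite /= (kid_child _ _ _ _ xe). Qed.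

Lemma tmax_root F j a l x : F (cube a l) <= tmax F j a l x.
Proof. by case: j => //= j; rewrite le_max lexx. Qed.

(** Used with the triangle inequality to recentre the maximum of |f_Q - c| at the average over a
    smaller cube. *)
Lemma tmax_leD F G (c : R) j a l x :
  (forall Q, F Q <= G Q + c) -> tmax F j a l x <= tmax G j a l x + c.
Proof.
move=> FG; elim: j a l => [|j IH] a l /=; first exact: FG.
by rewrite ge_max addr_maxl !le_max FG IH orbT.
Qed.

Lemma tmax_homo F a l x i j : (i <= j)%N -> tmax F i a l x <= tmax F j a l x.
Proof.
elim: i j a l => [|i IH] [|j] a l//= ij; first by rewrite le_max lexx.
by rewrite ge_max !le_max lexx/= IH// orbT.
Qed.

Lemma tmax_bounded F j a l : exists B : R, forall x, tmax F j a l x <= B.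
Proof.
elim: j a l => [|j IH] a l; first by exists (F (cube a l)).
have /choice[B BP] := fun e : dirs => IH (child a l e) (l / 2).
exists (\big[Num.max/F (cube a l)]_e B e) => x /=.
rewrite ge_max bigmax_ge_id/= (le_trans (BP _ x))//.
exact: le_bigmax.
Qed.

Lemma measurable_tmax F j a l : 0 < l ->
  measurable_fun (cube a l : set X) (tmax F j a l).
Proof.
elim: j a l => [|j IH] a l l0; first exact: measurable_cst.
move=> _ Y mY; rewrite setIC cube_children//.
(* On each child the function is the maximum of a constant and of the tree maximum of that child,
   which is measurable by induction. *)
apply: bigsetU_measurable => e _.
have := @measurable_maxr _ _ _ _ _ _ (@measurable_cst _ _ _ _ _ (F (cube a l)))
   (IH (child a l e) (l / 2) (divr_gt0 l0 (ltr0n _ 2))).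
move=> /(_ (measurable_cube _ _) _ mY); rewrite setIC.
congr measurable; apply/seteqP; split => x [H1 H2]; split => //.
- by have := tmax_child F j a l e x H2 => /= ->.
- by have := tmax_child F j a l e x H2 => /= <-.
Qed.

End tree.

(** * Weak type (1,1) inequality *)

Section averages.
Context {R : realType} {n : nat}.
Local Notation Rn := 'rV[R]_n.+1.
Local Notation X := (Rspace R n).
Implicit Types (a : Rn) (l c : R) (f : X -> R) (Q : set X).
Local Notation vol Q := (fine (leb (Q : set X))).
Hint Resolve measurable_cube : core.

Definition osc f Q : R := (vol Q)^-1 * \int[leb]_(x in Q) `|f x - avg f Q|.

Lemma vol_ge0 Q : 0 <= vol Q.
Proof. by rewrite fine_ge0. Qed.

Lemma integrable_cst_cube c a l : leb.-integrable (cube a l : set X) (EFin \o cst c).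
Proof.
apply/integrableP; split; first exact/measurable_EFinP/measurable_cst.
have /= -> := integral_cst leb (measurable_cube a l) `|c%:E|.
by rewrite lte_mul_pinfty// leb_cube_lt_pinfty.
Qed.

Lemma integrable_subc f c a l : leb.-integrable (cube a l : set X) (EFin \o f) ->
  leb.-integrable (cube a l : set X) (EFin \o (fun x => f x - c)).
Proof. by move=> If; exact: (integrableB _ If (integrable_cst_cube c a l)). Qed.

Lemma integrable_normc f c a l : leb.-integrable (cube a l : set X) (EFin \o f) ->
  leb.-integrable (cube a l : set X) (EFin \o (fun x => `|f x - c|)).
Proof. by move=> /(integrable_subc _ c)/integrable_norm. Qed.

Lemma avg_dist_le f c a l : leb.-integrable (cube a l : set X) (EFin \o f) ->
  `|avg f (cube a l) - c| * vol (cube a l) <= \int[leb]_(x in cube a l) `|f x - c|.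
Proof.
move=> If; have Ifc := integrable_subc _ c _ _ If.
apply: le_trans (le_normr_Rintegral (measurable_cube _ _) Ifc).
rewrite RintegralB//; last exact: (integrable_cst_cube c).
(* On a cube of measure 0 the average is a default value, but the left-hand side vanishes. *)
rewrite Rintegral_cst//; have [->|v0] := eqVneq (vol (cube a l)) 0.
  by rewrite mulr0.
rewrite -{1}(ger0_norm (vol_ge0 (cube a l))) -normrM mulrBl /avg.
by rewrite mulrAC mulVf// mul1r.
Qed.

Lemma vol_le (A : set X) a l : A `<=` cube a l -> vol A <= vol (cube a l).
Proof.
move=> Aal; have le := le_outer_measure lebesgue_outer_measure _ _ Aal.
have fin := leb_cube_lt_pinfty a l.
by rewrite fine_le// ge0_fin_numE// (le_lt_trans le).
Qed.

Lemma measurable_tmax_gt F (t : R) j a l : 0 < l ->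
  measurable ([set x | t < tmax F j a l x] `&` cube a l : set X).
Proof.
move=> l0; have := measurable_tmax F j a l l0 (measurable_cube _ _) _ (measurable_itv `]t, +oo[).
by rewrite setIC; congr measurable; apply/seteqP; split => x [H1 H2];
  split => //; move: H1; rewrite /= in_itv/= andbT.
Qed.

(** Either the average over the root already deviates from [c] by more than [t], and [avg_dist_le]
    bounds the whole cube; or the level set is the disjoint union of those of the children, and the
    induction hypotheses add up. *)
Lemma weak_type_tmax f c (t : R) j a l : 0 < t -> 0 < l ->
  leb.-integrable (cube a l : set X) (EFin \o f) ->
  t * vol ([set x | t < tmax (fun Q => `|avg f Q - c|) j a l x] `&` cube a l) <=
  \int[leb]_(x in cube a l) `|f x - c|.
Proof.
move=> t0; elim: j a l => [|j IH] a l l0 If.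
  have [tP|Pt] := ltP t `|avg f (cube a l) - c|.
    apply: le_trans (avg_dist_le _ _ _ _ If).
    by apply: ler_pM => //; [exact: ltW|exact: ltW|apply: vol_le; exact: subIsetr].
  rewrite (_ : _ `&` _ = set0); first by rewrite measure0 mulr0 Rintegral_ge0.
  by apply/seteqP; split => // x [].
have [tP|Pt] := ltP t `|avg f (cube a l) - c|.
  apply: le_trans (avg_dist_le _ _ _ _ If).
  by apply: ler_pM => //; [exact: ltW|exact: ltW|apply: vol_le; exact: subIsetr].
rewrite vol_children//; last exact: measurable_tmax_gt.
rewrite -[X in _ <= Rintegral _ X _]setTI Rintegral_children//; last 2 first.
  exact: measurableI.
  exact: integrable_normc.
rewrite mulr_sumr; apply: ler_sum => e _.
rewrite setTI (_ : _ `&` _ = [set x |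
  t < tmax (fun Q => `|avg f Q - c|) j (child a l e) (l / 2) x] `&`
  cube (child a l e) (l / 2)).
  apply: IH; first by rewrite divr_gt0.
  by apply: integrableS If => //; exact: child_sub.
by apply/seteqP; split => x [H1 xe]; split => //; move: H1;
  rewrite /mkset (tmax_child _ _ _ _ _ _ xe) lt_max ltNge Pt.
Qed.

End averages.

(** * Good-lambda inequality on a dyadic tree *)

Section good_lambda.
Context {R : realType} {n : nat}.
Local Notation Rn := 'rV[R]_n.+1.
Local Notation X := (Rspace R n).
Local Notation dirs := {ffun 'I_n.+1 -> bool}.
Implicit Types (a : Rn) (l c : R) (f v : X -> R) (Q : set X).
Local Notation vol Q := (fine (leb (Q : set X))).
Hint Resolve measurable_cube : core.

Lemma dyadic_sub a0 l0 Q : dyadic (cube a0 l0 : set X) Q -> Q `<=` cube a0 l0.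
Proof.
elim=> // a l e lp _ IH; apply: subset_trans IH.
rewrite (_ : cube _ _ = cube (child a l (finfun e)) (l / 2)); first exact: child_sub.
by congr cube; congr (_ + _); apply/rowP => i; rewrite !mxE ffunE.
Qed.

Lemma dyadic_child a0 l0 a l (e : dirs) : 0 < l -> dyadic (cube a0 l0 : set X) (cube a l) ->
  dyadic (cube a0 l0 : set X) (cube (child a l e) (l / 2)).
Proof. by move=> lp; exact: dyadic_bisect. Qed.

(** A division-free form of the A_infty condition for a weight that is nonnegative everywhere: [s]
    is any upper bound for |E|/|Q|. Positivity of the volumes is recorded as well. *)
Definition dyadic_weight a0 l0 v Cw dw :=
  [/\ forall x, 0 <= v x, measurable_fun (cube a0 l0 : set X) v &
    forall Q, dyadic (cube a0 l0) Q ->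
      [/\ 0 < vol Q, (weight_of v Q < +oo)%E &
        forall (E : set X) s, measurable E -> E `<=` Q -> 0 <= s -> vol E <= s * vol Q ->
          (weight_of v E <= (Cw * s `^ dw)%:E * weight_of v Q)%E]].

Lemma osc_vol f a l : leb.-integrable (cube a l : set X) (EFin \o f) ->
  0 < vol (cube a l) ->
  \int[leb]_(x in cube a l) `|f x - avg f (cube a l)| = osc f (cube a l) * vol (cube a l).
Proof. by move=> If v0; rewrite /osc mulrAC mulVf ?mul1r// gt_eqF. Qed.

(** The integral of |f - f_Q| over the child is at most that over Q, and |Q| is [#|dirs|] times the
    measure of the child. *)
Lemma avg_child_dist f a l (e : dirs) : 0 < l ->
  leb.-integrable (cube a l : set X) (EFin \o f) ->
  0 < vol (cube (child a l e) (l / 2)) ->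
  `|avg f (cube (child a l e) (l / 2)) - avg f (cube a l)| <=
    #|dirs|%:R * osc f (cube a l).
Proof.
move=> l0 If ve.
have Ife : leb.-integrable (cube (child a l e) (l / 2) : set X) (EFin \o f).
  by apply: integrableS If => //; exact: child_sub.
have K0 : 0 < #|dirs|%:R :> R by rewrite ltr0n; apply/card_gt0P; exists e.
have vP : 0 < vol (cube a l) by rewrite (leb_child _ _ e)// mulr_gt0.
rewrite -(ler_pM2r ve) mulrAC -leb_child// [leRHS]mulrC -osc_vol//.
apply: le_trans (avg_dist_le _ _ _ _ Ife) _.
apply: fine_le.
- apply: integrable_fin_num => //; exact: integrable_normc.
- apply: integrable_fin_num => //; exact: integrable_normc.
- apply: ge0_subset_integral; [by []|by []| |by []|exact: child_sub].
  by apply: measurable_int; exact: integrable_normc.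
Qed.

Lemma measurable_tmax_gt_le F G (t s : R) j a l : 0 < l ->
  measurable ([set x | t < tmax F j a l x /\ tmax G j a l x <= s] `&` cube a l : set X).
Proof.
move=> l0.
have := measurableD (measurable_tmax_gt F t j a l l0) (measurable_tmax_gt G s j a l l0).
congr measurable; apply/seteqP; split => x /=.
  by move=> [[? xal] H]; split => //; split => //; rewrite leNgt; apply/negP => ?; apply: H.
by move=> [[? xs] ?]; split => // -[]; rewrite ltNge xs.
Qed.

Let jump_arith (K o g lam d1 d2 d3 : R) : 0 <= K -> o <= g * lam ->
  K * g <= 2^-1 -> 0 <= lam -> d1 <= K * o -> d2 <= lam -> d3 <= d1 + d2 ->
  d3 <= 3 / 2 * lam.
Proof.
move=> K0 og Kg l0 d1K d2l d3d.
have : K * o <= K * (g * lam) by exact: ler_wpM2l.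
have : K * g * lam <= 2^-1 * lam by exact: ler_wpM2r.
lra.
Qed.

Let level_arith (lam t d : R) : 2 * lam < t + d -> d <= 3 / 2 * lam -> lam / 2 < t.
Proof. lra. Qed.

Let vol_arith (lam g o V s s' : R) : 0 < lam -> lam / 2 * s' <= o * V ->
  o <= g * lam -> 0 <= V -> s <= s' -> s <= 2 * g * V.
Proof.
move=> l0 sV ol V0 ss.
have H : o * V <= g * lam * V by exact: ler_wpM2r.
have H' : lam / 2 * s <= lam / 2 * s' by apply: ler_wpM2l => //; lra.
have l2 : 0 < lam / 2 by lra.
rewrite -(ler_pM2l l2); lra.
Qed.

(** The induction carries the invariant that the average over the current cube is within [lam] of
    [c]. A child that keeps the invariant is handled by induction; a child that breaks it lies
    entirely in the set on the right, and there the A_infty condition is applied directly. *)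
Lemma good_lambda_tmax f v c (g Cw dw : R) a0 l0 (lam : R) j a l :
  dyadic_weight a0 l0 v Cw dw -> leb.-integrable (cube a0 l0 : set X) (EFin \o f) ->
  0 <= Cw -> 0 < g -> #|dirs|%:R * g <= 2^-1 -> 0 < lam ->
  0 < l -> dyadic (cube a0 l0 : set X) (cube a l) -> `|avg f (cube a l) - c| <= lam ->
  (weight_of v ([set x | (2 * lam < tmax (fun Q => `|avg f Q - c|) j a l x)%R /\
                         (tmax (osc f) j a l x <= g * lam)%R] `&` cube a l) <=
   (Cw * (2 * g) `^ dw)%:E *
   weight_of v ([set x | (lam < tmax (fun Q => `|avg f Q - c|) j a l x)%R] `&`
                cube a l))%E.
Proof.
move=> [v0 mv Hv] If Cw0 g0 Kg lam0; have lam2 : lam < 2 * lam by lra.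
have W0 (E : set X) : (0 <= weight_of v E)%E.
  by apply: integral_ge0 => x _; rewrite lee_fin.
have C0 : (0 <= (Cw * (2 * g) `^ dw)%:E)%E by rewrite lee_fin mulr_ge0// powR_ge0.
elim: j a l => [|j IH] a l l_gt0 dP Pl.
  set S := (X in (weight_of v X <= _)%E).
  have -> : S = set0.
    by apply/seteqP; split => // x [[Nx _] _]; move: Nx Pl; rewrite /=; lra.
  rewrite {1}/weight_of integral_set0; apply: mule_ge0 => //; exact: W0.
pose N := tmax (fun Q => `|avg f Q - c|) j.+1 a l.
pose M := tmax (osc f) j.+1 a l.
rewrite -/N -/M.
have PQ0 := dyadic_sub _ _ _ dP.
have mvP : measurable_fun (cube a l : set X) (EFin \o v).
  by apply/measurable_EFinP; apply: measurable_funS mv.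
have IfP : leb.-integrable (cube a l : set X) (EFin \o f) by exact: integrableS If.
rewrite /weight_of !ge0_integral_children//; last 4 first.
- exact: measurable_tmax_gt.
- by move=> x _; rewrite lee_fin.
- exact: measurable_tmax_gt_le.
- by move=> x _; rewrite lee_fin.
rewrite ge0_sume_distrr; last by move=> e _; exact: W0.
apply: lee_sum => e _; rewrite -!/(weight_of v _).
set Pe := cube (child a l e) (l / 2).
have l20 : 0 < l / 2 by rewrite divr_gt0.
have dPe : dyadic (cube a0 l0 : set X) Pe by exact: dyadic_child.
have [vPe Wfin HPe] := Hv _ dPe.
have IfPe : leb.-integrable (Pe : set X) (EFin \o f).
  by apply: integrableS IfP; [exact: measurable_cube..|exact: child_sub].
set Ne := tmax (fun Q => `|avg f Q - c|) j (child a l e) (l / 2).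
set Me := tmax (osc f) j (child a l e) (l / 2).
have NE x : Pe x -> N x = Num.max `|avg f (cube a l) - c| (Ne x).
  by move=> xe; rewrite /N (tmax_child _ _ _ _ _ _ xe).
have ME x : Pe x -> M x = Num.max (osc f (cube a l)) (Me x).
  by move=> xe; rewrite /M (tmax_child _ _ _ _ _ _ xe).
have [Pel|lPe] := leP `|avg f Pe - c| lam.
  apply: (@le_trans _ _ (weight_of v
      ([set x | (2 * lam < Ne x)%R /\ (Me x <= g * lam)%R] `&` Pe))).
    apply: ge0_subset_integral.
    - by apply: measurable_child => //; exact: measurable_tmax_gt_le.
    - exact: measurable_tmax_gt_le.
    - by apply: measurable_funS mvP; [exact: measurable_cube|move=> x [_]; exact: child_sub].
    - by move=> x _; rewrite lee_fin.
    - move=> x [[Nx Mx] xe]; split => //; move: Nx Mx.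
      rewrite NE// ME// lt_max ge_max => /orP[NP|? /andP[_ ?]]; last by split.
      by have := lt_trans lam2 (lt_le_trans NP Pl); rewrite ltxx.
  rewrite (_ : [set x | lam < N x] `&` Pe = [set x | lam < Ne x] `&` Pe).
    exact: IH.
  apply/seteqP; split => x [Nx xe]; split => //; move: Nx.
    by rewrite /mkset NE// lt_max [lam < `|_|]ltNge Pl.
  by rewrite /mkset NE// lt_max => ->; rewrite orbT.
rewrite (_ : [set x | lam < N x] `&` Pe = Pe); last first.
  apply/setIidr => x xe; rewrite /mkset NE// lt_max; apply/orP; right.
  exact: lt_le_trans lPe (tmax_root _ _ _ _ _).
have empty_le (E : set X) : (forall x, E x -> False) -> (weight_of v E <=
    (Cw * (2 * g) `^ dw)%:E * weight_of v Pe)%E.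
  move=> E0; rewrite (_ : E = set0); last by apply/seteqP; split => // x /E0.
  rewrite {1}/weight_of integral_set0; apply: mule_ge0 => //; exact: W0.
(* From here on the child breaks the invariant. If the oscillation over the parent or over the child
   exceeds [g * lam], no point of the child lies in the set on the left. *)
have [oscP|oscP] := ltP (g * lam) (osc f (cube a l)).
  apply: empty_le => x [[_ Mx] xe]; move: Mx.
  by rewrite ME// ge_max => /andP[oscM _]; have := lt_le_trans oscP oscM; rewrite ltxx.
have [oscPe|oscPe] := ltP (g * lam) (osc f Pe).
  apply: empty_le => x [[_ Mx] xe]; move: Mx.
  rewrite ME// ge_max => /andP[_ MeL].
  have := le_lt_trans (le_trans (tmax_root _ _ _ _ _) MeL) oscPe; by rewrite ltxx.
apply: HPe => //.
- by apply: measurable_child => //; exact: measurable_tmax_gt_le.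
- by rewrite mulr_ge0// ltW.
(* The parent contributes at most [lam], and the step to the child at most [#|dirs|%:R * g * lam],
   which is at most lam / 2. *)
have jump : `|avg f Pe - c| <= 3 / 2 * lam.
  have jP := avg_child_dist f a l e l_gt0 IfP vPe.
  apply: (jump_arith _ _ _ _ _ _ _ (ler0n _ _) oscP Kg (ltW lam0) jP Pl); exact: ler_distD.
(* The level lam / 2 is what remains of 2 lam after recentring from [c] to the average over [Pe], a
   shift of at most 3/2 lam. *)
have weak := weak_type_tmax f (avg f Pe) (lam / 2) j _ _ (divr_gt0 lam0 (ltr0n _ 2)) l20 IfPe.
rewrite osc_vol// in weak.
set S := (X in vol X <= _).
set S' := (X in _ * vol X) in weak.
have SS' : S `<=` S'.
  move=> x [[Nx _] xe]; split => //; move: Nx; rewrite NE// lt_max => /orP[|NeL].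
    by move=> NP; have := lt_trans lam2 (lt_le_trans NP Pl); rewrite ltxx.
  have := @tmax_leD _ _ (fun Q => `|avg f Q - c|) (fun Q => `|avg f Q - avg f Pe|)
     (`|avg f Pe - c|) j (child a l e) (l / 2) x (fun Q => ler_distD _ _ _).
  rewrite -/Ne => le; have := lt_le_trans NeL le => {}le.
  exact: (level_arith _ _ _ le jump).
have : vol S <= vol S'.
  have leS' : (leb S' < +oo)%E.
    apply: le_lt_trans (leb_cube_lt_pinfty (child a l e) (l / 2)).
    by apply: (le_outer_measure lebesgue_outer_measure) => x [].
  have le := le_outer_measure lebesgue_outer_measure _ _ SS'.
  by apply: fine_le => //; rewrite ge0_fin_numE// (le_lt_trans le).
move=> SS; exact: (vol_arith _ _ _ _ _ _ lam0 weak oscPe (ltW vPe) SS).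
Qed.

End good_lambda.

(** * Dyadic Lebesgue differentiation *)

Section differentiation.
Context {R : realType} {n : nat}.
Local Notation Rn := 'rV[R]_n.+1.
Local Notation X := (Rspace R n).
Local Notation dirs := {ffun 'I_n.+1 -> bool}.
Implicit Types (a : Rn) (l c : R) (f h : X -> R) (Q E U : set X).
Hint Resolve measurable_cube : core.

Fixpoint gencube k a l (x : Rn) : set X :=
  if k is k'.+1 then gencube k' (kid a l x) (l / 2) x else cube a l.

Lemma gencube_child k a l (e : dirs) x : cube (child a l e) (l / 2) x ->
  gencube k.+1 a l x = gencube k (child a l e) (l / 2) x.
Proof. by move=> xe; rewrite /= (kid_child _ _ _ _ xe). Qed.

Lemma mem_gencube k a l x : cube a l x -> gencube k a l x x.
Proof. by elim: k a l => //= k IH a l /mem_kid/IH. Qed.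

Lemma gencube_sub k a l x : 0 < l -> gencube k a l x `<=` cube a l.
Proof.
elim: k a l => [|k IH] a l l0 y //= /(IH _ _ (divr_gt0 l0 (ltr0n _ 2))).
exact: child_sub.
Qed.

Lemma gencubeS k a l x : 0 < l -> gencube k.+1 a l x `<=` gencube k a l x.
Proof.
elim: k a l => [|k IH] a l l0; first exact: child_sub.
by apply: IH; rewrite divr_gt0.
Qed.

Lemma gencube_eq k a l x y : 0 < l -> gencube k a l x y -> gencube k a l y = gencube k a l x.
Proof.
elim: k a l => [|k IH] a l l0 //= xy; have l20 : 0 < l / 2 by rewrite divr_gt0.
by rewrite (kid_child _ _ _ _ (gencube_sub _ _ _ _ l20 _ xy)) IH.
Qed.

Lemma gencube_diam k a l x y i : cube a l x -> gencube k a l x y ->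
  `|y ord0 i - x ord0 i| < l / 2 ^+ k.
Proof.
elim: k a l => [|k IH] a l xa /= xy.
  by rewrite expr0 divr1 ltr_norml; have := xa i; have := xy i; rewrite !mxE; lra.
by rewrite exprS invfM mulrA; apply: IH xy; exact: mem_kid.
Qed.

Lemma le_tmax_gencube F k a l x : F (gencube k a l x) <= tmax F k a l x.
Proof. by elim: k a l => //= k IH a l; rewrite le_max IH orbT. Qed.

(** Whatever [Pr] is, the set is a finite union of cubes of generation [k]. *)
Lemma measurable_gencube_pred (Pr : set X -> Prop) k a l : 0 < l ->
  measurable ([set x | Pr (gencube k a l x)] `&` cube a l : set X).
Proof.
elim: k a l => [|k IH] a l l0.
  have [P|NP] := pselect (Pr (cube a l)).
    by rewrite (_ : _ `&` _ = cube a l)//; exact/setIidr.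
  rewrite (_ : _ `&` _ = set0)//.
  by apply/seteqP; split => // x [].
rewrite cube_children//; apply: bigsetU_measurable => e _.
rewrite (_ : _ `&` _ = [set x | Pr (gencube k (child a l e) (l / 2) x)] `&`
   cube (child a l e) (l / 2)); first by apply: IH; rewrite divr_gt0.
by apply/seteqP; split => x [xP xe]; split => //; move: xP;
  rewrite /mkset (gencube_child _ _ _ _ _ xe).
Qed.

Lemma integral_gencube_le0 (Pr : set X -> Prop) h k a l : 0 < l ->
  leb.-integrable (cube a l : set X) (EFin \o h) ->
  (forall x, cube a l x -> Pr (gencube k a l x) ->
     \int[leb]_(y in gencube k a l x) h y <= 0) ->
  \int[leb]_(y in [set x | Pr (gencube k a l x)] `&` cube a l) h y <= 0.
Proof.
elim: k a l => [|k IH] a l l0 Ih H.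
  have [P|NP] := pselect (Pr (cube a l)).
    rewrite (_ : _ `&` _ = cube a l); last exact/setIidr.
    have [->|/set0P[x xa]] := eqVneq (cube a l) set0; first by rewrite Rintegral_set0.
    exact: (H x).
  rewrite (_ : _ `&` _ = set0) ?Rintegral_set0//.
  by apply/seteqP; split => // x [].
rewrite Rintegral_children//; last exact: measurable_gencube_pred.
apply: sumr_le0 => e _.
rewrite (_ : _ `&` _ = [set x | Pr (gencube k (child a l e) (l / 2) x)] `&`
   cube (child a l e) (l / 2)).
  apply: IH; first by rewrite divr_gt0.
    by apply: integrableS Ih => //; exact: child_sub.
  move=> x xe; have := H x (child_sub _ _ _ l0 _ xe).
  by rewrite (gencube_child _ _ _ _ _ xe).
by apply/seteqP; split => x [xP xe]; split => //; move: xP;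
  rewrite /mkset (gencube_child _ _ _ _ _ xe).
Qed.

(* One-sided form of Lebesgue differentiation.  Given an open U containing E with
   U minus E small, let V k be the union of the generation-k cubes that lie in U
   and meet E.  The integral of h over V k is nonpositive, and V k cap E increases
   to E, so the integral of h over E is at most that of |h| over U minus E. *)
Lemma le0_gencube_null h a l E : 0 < l ->
  leb.-integrable (cube a l : set X) (EFin \o h) ->
  measurable E -> E `<=` cube a l -> (forall x, E x -> 0 < h x) ->
  (forall x k, E x -> \int[leb]_(y in gencube k a l x) h y <= 0) ->
  leb E = 0%E.
Proof.
move=> l0 Ih mE EP h0 hk.
have IhE : leb.-integrable E (EFin \o h) by exact: integrableS Ih.
have Efin : (leb E < +oo)%E.
  by apply: le_lt_trans (leb_cube_lt_pinfty a l); exact: (le_outer_measure lebesgue_outer_measure).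
(* As [h] is positive on [E], a nonpositive integral forces h = 0 almost everywhere on [E], so [E]
   is null. *)
suff int0 : (\int[leb]_(x in E) (h x)%:E <= 0)%E.
  have mh : measurable_fun E (EFin \o h) by exact: measurable_int IhE.
  have : (\int[leb]_(x in E) `|(EFin \o h) x| = 0)%E.
    apply/eqP; rewrite eq_le; apply/andP; split; last exact: integral_ge0.
    apply: le_trans int0; rewrite le_eqVlt; apply/orP; left; apply/eqP.
    by apply: eq_integral => x /set_mem Ex /=; rewrite gtr0_norm// h0.
  move/(ae_eq_integral_abs leb mE mh) => aeh.
  apply/(negligibleP leb mE); apply: negligibleS aeh => x Ex /= hx.
  by have := h0 x Ex; have [->] := hx Ex; rewrite ltxx.
have Ihr : leb.-integrable [set: X] (EFin \o (h \_ (cube a l : set X))).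
  by rewrite -restrict_EFin; apply/(integrable_mkcond _ (measurable_cube a l)).
have small (e : R) : 0 < e -> (\int[leb]_(x in E) (h x)%:E <= e%:E)%E.
  (* Absolute continuity of the integral, for [h] extended by 0 outside the cube. Below, d / 2 makes
     the bound on the measure of U minus E strict. *)
  move=> e0; have [d [d0 dP]] := integral_normr_continuous Ihr e0.
  have [U [mU EU leU Unb]] := leb_outer_regular E (d / 2) mE Efin (divr_gt0 d0 (ltr0n _ 2)).
  pose Pr Q := Q `<=` U /\ exists2 y, E y & Q y.
  pose V k : set X := [set x | Pr (gencube k a l x)] `&` cube a l.
  have mV k : measurable (V k) by exact: measurable_gencube_pred.
  have VP k : V k `<=` cube a l by move=> x [].
  have VU k : V k `<=` U.
    by move=> x [[QU _] xa]; apply: QU; exact: mem_gencube.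
  have EV k : \int[leb]_(x in V k `&` E) h x <= e.
    have Vle0 : \int[leb]_(x in V k) h x <= 0.
      apply: integral_gencube_le0 => // x xa [_ [y Ey xy]].
      (* A cube making up [V k] contains some [y] in [E], so it is the generation-[k] cube of [y],
         where the hypothesis on averages holds. *)
      by rewrite -(gencube_eq _ _ _ _ _ l0 xy); exact: hk.
    have mVE : measurable (V k `\` E) by exact: measurableD.
    have IVE : leb.-integrable (V k `\` E) (EFin \o h).
      by apply: integrableS Ih => // x [/VP].
    have : \int[leb]_(x in V k `\` E) `|(h \_ (cube a l : set X)) x| < e.
      apply: dP => //; apply: (@le_lt_trans _ _ (leb (U `\` E))).
        by apply: (le_outer_measure lebesgue_outer_measure) => x [/VU].
      by rewrite (le_lt_trans leU)// lte_fin gtr_pMr// invf_lt1 ?ltr1n.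
    rewrite (@eq_Rintegral _ _ _ _ _ (fun x => `|h x|)); last first.
      by move=> x /set_mem[/VP xa _]; rewrite patchE mem_set.
    have := le_normr_Rintegral mVE IVE; move: Vle0.
    rewrite -{1}(setUIDK (V k) E) Rintegral_setU//.
    - by rewrite ler_norml => ? /andP[? _] ?; lra.
    - exact: measurableI.
    - by rewrite setUIDK; exact: integrableS Ih.
    - by apply/disj_setPS => x [[_ ?] [_]].
  have mVE k : measurable (V k `&` E) by exact: measurableI.
  have <- : \bigcup_k (V k `&` E) = E.
    apply/seteqP; split => [x [k _ []]//|x Ex].
    have [r [r0 rU]] := Unb x Ex.
    (* With this generation k, l / r < k < 2 ^ k, so the cube around [x] has edge below [r] and lies
       in [U]. *)
    exists (Num.bound (l / r)) => //; split=> //; split; last exact: EP.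
    split; last by exists x => //; apply: mem_gencube; exact: EP.
    move=> y xy; apply: rU => i; apply: lt_trans (gencube_diam _ _ _ _ _ _ (EP _ Ex) xy) _.
    rewrite ltr_pdivrMr ?exprn_gt0// mulrC -ltr_pdivrMr//.
    apply: lt_trans (archi_boundP _) _; first by rewrite divr_ge0// ltW.
    by rewrite -natrX ltr_nat ltn_expl.
  have ndV : {homo (fun k => V k `&` E) : n0 m / (n0 <= m)%N >-> (n0 <= m)%O}.
    apply/nondecreasing_seqP => k; apply/subsetPset => x [[[QU Qx] xa] Ex].
    split=> //; split => //; split; first by apply: subset_trans QU; exact: gencubeS.
    by exists x => //; exact: mem_gencube.
  have mhV k : measurable_fun (V k `&` E) (EFin \o h).
    by apply: measurable_int; apply: integrableS Ih => // x [/VP].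
  have h0V k x : (V k `&` E) x -> (0 <= (EFin \o h) x)%E.
    by move=> [_ Ex]; rewrite lee_fin ltW// h0.
  have cvgV := ge0_nondecreasing_set_cvg_integral (mu := leb) ndV mVE mhV h0V.
  rewrite -(cvg_lim _ cvgV)//; apply: lime_le; first by apply/cvg_ex; eexists; exact: cvgV.
  near=> k; have := EV k; rewrite -lee_fin /Rintegral fineK//.
  by apply: integrable_fin_num => //; apply: integrableS Ih => // x [/VP].
by apply/lee_addgt0Pr => e e0; rewrite add0e; exact: small.
Unshelve. all: by end_near. Qed.
End differentiation.

(** * Domination of |f - c| by the dyadic averages almost everywhere *)

Section tmax_ae.
Context {R : realType} {n : nat}.
Local Notation Rn := 'rV[R]_n.+1.
Local Notation X := (Rspace R n).
Implicit Types (a : Rn) (l c : R) (f : X -> R) (Q : set X).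
Local Notation vol Q := (fine (leb (Q : set X))).
Hint Resolve measurable_cube : core.

Lemma gencube_cube k a l x : 0 < l ->
  exists b r, 0 < r /\ gencube k a l x = cube b r.
Proof.
elim: k a l => [|k IH] a l l0 /=; first by exists a, l.
by apply: IH; rewrite divr_gt0.
Qed.

Lemma Rintegral_avg f a l : leb.-integrable (cube a l : set X) (EFin \o f) ->
  \int[leb]_(x in cube a l) f x = avg f (cube a l) * vol (cube a l).
Proof.
move=> If; have [v0|v0] := eqVneq (vol (cube a l)) 0; last first.
  by rewrite /avg mulrAC mulVf// mul1r.
rewrite v0 mulr0; apply/eqP; rewrite -normr_le0.
apply: le_trans (le_normr_Rintegral (measurable_cube _ _) If) _.
rewrite /Rintegral [X in fine X](_ : _ = 0%E)//.
rewrite (eq_integral (fun x => `|(f x)%:E|%E))//; apply: integral_abs_eq0 => //.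
  exact: measurable_int If.
by rewrite leb_cubeE v0.
Qed.

(** For s = 1 and s = -1, the function s (f - c) - q has nonpositive integral over every dyadic cube
    around a point of [A]. By [le0_gencube_null] it is positive only on a null part of [A]; the two
    signs together cover the bad set. *)
Lemma tmax_lt_null f c (q : R) a l : 0 < l ->
  leb.-integrable (cube a l : set X) (EFin \o f) ->
  leb.-negligible [set x | [/\ cube a l x,
    forall j, tmax (fun Q => `|avg f Q - c|) j a l x <= q & q < `|f x - c| ]].
Proof.
move=> l0 If.
pose A : set X := cube a l `&` [set x | forall j, tmax (fun Q => `|avg f Q - c|) j a l x <= q].
have mA : measurable A.
  rewrite (_ : A = \bigcap_j (cube a l `\`
      ([set x | q < tmax (fun Q => `|avg f Q - c|) j a l x] `&` cube a l))).
    by apply: bigcapT_measurable => j; apply: measurableD => //; exact: measurable_tmax_gt.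
  apply/seteqP; split => [x [xa xq] j _|x xA].
    by split => // -[/=]; rewrite ltNge xq.
  split; first by have [] := xA 0%N I.
  move=> j; rewrite leNgt; apply/negP => qx; have [xa] := xA j I.
  by apply; split.
have Ifs s : leb.-integrable (cube a l : set X) (EFin \o (fun x => s * (f x - c) - q)).
  apply: integrable_subc; rewrite (_ : _ \o _ = (fun x => s%:E * (f x - c)%:E)%E).
    by apply: integrableZl => //; exact: integrable_subc.
  by apply/funext => x.
have mAs s : measurable (A `&` [set x | 0 < s * (f x - c) - q]).
  have /measurable_EFinP mf := measurable_int _ (Ifs s).
  rewrite (_ : _ `&` _ = A `&` (cube a l `&` (fun x => s * (f x - c) - q) @^-1` `]0, +oo[)).
    by apply: measurableI => //; exact: mf.
  apply/seteqP; split => x /=.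
    by move=> [[xa ?] ?]; do !split => //; rewrite in_itv/= andbT.
  by move=> [? [_]]; rewrite in_itv/= andbT.
have null s : `|s| = 1 -> leb (A `&` [set x | 0 < s * (f x - c) - q]) = 0%E.
  move=> s1; apply: (le0_gencube_null (fun x => s * (f x - c) - q) a l) => //.
  - by move=> x [[]].
  - by move=> x [].
  - move=> x k [[xa xq] _]; have [b [r [r0 Q]]] := gencube_cube k a l x l0.
    have subQ : cube b r `<=` cube a l by rewrite -Q; exact: gencube_sub.
    have IfQ : leb.-integrable (cube b r : set X) (EFin \o f) by exact: integrableS If.
    have IfcQ := integrable_subc _ c _ _ IfQ.
    rewrite Q RintegralB//; last 2 first.
    - exact: (integrableZl (measurable_cube b r) s IfcQ).
    - exact: (integrable_cst_cube q).
    rewrite RintegralZl// RintegralB//; last exact: (integrable_cst_cube c).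
    rewrite !Rintegral_cst// Rintegral_avg// -mulrBl mulrA -mulrBl.
    rewrite mulr_le0_ge0 ?vol_ge0// subr_le0.
    apply: le_trans (xq k); apply: le_trans (le_tmax_gencube _ _ _ _ _).
    by rewrite Q; apply: le_trans (ler_norm _) _; rewrite normrM s1 mul1r.
apply: (@negligibleS _ _ _ _ ((A `&` [set x | 0 < 1 * (f x - c) - q]) `|`
   (A `&` [set x | 0 < -1 * (f x - c) - q]))).
  move=> x [xa xq]; rewrite ltr_normr => /orP[] ?; [left|right]; split => //=.
    by rewrite mul1r subr_gt0.
  by rewrite mulN1r subr_gt0.
by apply: negligibleU; apply/negligibleP => //; apply: null; rewrite ?normrN normr1.
Qed.

(** This says that |f - c| is at most the supremum of the tree maxima. A rational between [t] and
    |f(x) - c| reduces the exceptional set to countably many null sets, independent of [t]. *)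
Lemma ae_tmax f c a l : 0 < l ->
  leb.-integrable (cube a l : set X) (EFin \o f) ->
  {ae leb, forall x, cube a l x -> forall t : R, t < `|f x - c| ->
     exists j, t < tmax (fun Q => `|avg f Q - c|) j a l x}.
Proof.
move=> l0 If.
pose F k : set X := if unpickle k is Some q then [set x | [/\ cube a l x,
    forall j, tmax (fun Q => `|avg f Q - c|) j a l x <= ratr (q : rat) &
    ratr q < `|f x - c| ]] else set0.
have nF k : leb.-negligible (F k).
  rewrite /F; case: unpickle => [q|]; first exact: tmax_lt_null.
  exact: negligible_set0.
apply: negligibleS (negligible_bigcup nF) => x /= H.
apply: contrapT => nFx; apply: H => xa t tf; apply: contrapT => nj.
have [q /[!in_itv]/= /andP[tq qf]] := rat_in_itvoo tf.
apply: nFx; exists (pickle q); [exact: I|rewrite /F pickleK; split; [exact: xa| |exact: qf] => j].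
apply: le_trans (ltW tq); rewrite leNgt; apply/negP => tj; apply: nj.
by exists j.
Qed.
End tmax_ae.

(** * Integration of a good-lambda inequality *)

Section level_sums.
Context {R : realType}.
Implicit Types (p t x : R) (i m : nat).

Lemma powR_le_level_sum p t x m : 0 <= p -> 0 < t -> 0 <= x -> x <= 2 ^+ m * t ->
  x `^ p <= t `^ p + \sum_(i < m) (2 ^+ i.+1 * t) `^ p * (2 ^+ i * t < x)%R%:R.
Proof.
move=> p0 t0 x0; have le_pow (y z : R) : 0 <= y -> y <= z -> y `^ p <= z `^ p.
  by move=> y0 yz; apply: ge0_ler_powR => //; rewrite nnegrE// (le_trans y0).
elim: m => [|m IH].
  by rewrite expr0 mul1r big_ord0 addr0; exact: le_pow.
rewrite big_ord_recr/= addrA; have [tx xm|xm _] := ltP (2 ^+ m * t) x.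
  rewrite mulr1; apply: (le_trans (le_pow _ _ x0 xm)); rewrite lerDr addr_ge0 ?powR_ge0//.
  by apply: sumr_ge0 => i _; rewrite mulr_ge0// powR_ge0.
by rewrite mulr0 addr0; exact: IH.
Qed.

Lemma level_sum_le_powR p t x m : 1 <= p -> 0 < t -> 0 <= x ->
  \sum_(i < m) (2 ^+ i * t) `^ p * (2 ^+ i * t < x)%R%:R <= 2 * x `^ p.
Proof.
move=> p1 t0 x0; have p0 : 0 <= p by exact: le_trans p1.
have u0 i : 0 <= 2 ^+ i * t by rewrite mulr_ge0// ?exprn_ge0// ltW.
have geom k : \sum_(i < k) (2 ^+ i * t) `^ p * (2 ^+ i * t < x)%R%:R <= (2 ^+ k * t) `^ p.
  elim: k => [|k IH]; first by rewrite big_ord0 powR_ge0.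
  rewrite big_ord_recr/=; apply: (@le_trans _ _ ((2 ^+ k * t) `^ p + (2 ^+ k * t) `^ p)).
    by apply: lerD => //; rewrite ler_piMr ?powR_ge0//; case: (_ < _).
  rewrite exprS -mulrA [(2 * _) `^ _]powRM ?u0// -mulr2n -[leLHS]mulr_natl ler_wpM2r ?powR_ge0//.
  by rewrite -{1}(@powRr1 _ 2)// ler_powR// ler1n.
elim: m => [|m IH]; first by rewrite big_ord0 mulr_ge0// powR_ge0.
rewrite big_ord_recr/=; have [tx|_] := ltP (2 ^+ m * t) x; last by rewrite mulr0 addr0.
have le_pow : (2 ^+ m * t) `^ p <= x `^ p.
  by apply: ge0_ler_powR; rewrite ?nnegrE// ltW.
have : 2 * x `^ p = x `^ p + x `^ p by rewrite mulr_natl mulr2n.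
by have := le_trans (geom m) le_pow; rewrite mulr1; lra.
Qed.

(* The sum S of the a_i s_i is finite, so the part e S that the good-lambda
   inequality returns can be absorbed. *)
Lemma level_sum_absorb (a s r : nat -> R) (K e w : R) m :
  0 <= K -> K * e <= 2^-1 -> (forall i, 0 <= a i) -> (forall i, 0 <= s i) ->
  (forall i, a i.+1 = K * a i) -> s 0%N <= w ->
  (forall i, s i.+1 <= e * s i + r i) ->
  \sum_(i < m) a i * s i <= 2 * (a 0%N * w + K * \sum_(i < m) a i * r i).
Proof.
move=> K0 Ke a0 s0 aS sw sS; set S := \sum_(i < m) a i * s i.
have S0 : 0 <= S by apply: sumr_ge0 => i _; exact: mulr_ge0.
have : S <= \sum_(i < m.+1) a i * s i by rewrite big_ord_recr/= lerDl mulr_ge0.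
rewrite big_ord_recl/= => H.
have H1 : a 0%N * s 0%N <= a 0%N * w by exact: ler_wpM2l.
(* The inequality links levels i + 1 and i; the shift of index costs the factor [K], whence the
   condition K e <= 1/2. *)
have H2 : \sum_(i < m) a (bump 0 i) * s (bump 0 i) <=
    K * e * S + K * \sum_(i < m) a i * r i.
  rewrite mulr_sumr mulr_sumr -big_split/=; apply: ler_sum => i _.
  rewrite /bump/= add1n aS; have := ler_wpM2l (mulr_ge0 K0 (a0 i)) (sS i).
  by move=> /le_trans; apply; rewrite le_eqVlt; apply/orP; left; apply/eqP; ring.
have H3 : K * e * S <= 2^-1 * S by exact: ler_wpM2r.
lra.
Qed.

End level_sums.

Section good_lambda_integral.
Context d (T : measurableType d) (R : realType) (mu : {measure set T -> \bar R}).
Variables (D : set T) (v : T -> R).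
Hypotheses (mD : measurable D) (v0 : forall x, 0 <= v x) (mv : measurable_fun D v).
Let W (E : set T) : \bar R := (\int[mu]_(x in E) (v x)%:E)%E.
Hypothesis WD : (W D < +oo)%E.

Let W_ge0 E : (0 <= W E)%E.
Proof. by apply: integral_ge0 => x _; rewrite lee_fin. Qed.

Let W_le E F : measurable E -> measurable F -> F `<=` D -> E `<=` F -> (W E <= W F)%E.
Proof.
move=> mE mF FD EF; apply: ge0_subset_integral => //; last by move=> x _; rewrite lee_fin.
by apply/measurable_EFinP; apply: measurable_funS mv.
Qed.

Let W_fin E : measurable E -> E `<=` D -> W E = (fine (W E))%:E.
Proof.
move=> mE ED; rewrite fineK// ge0_fin_numE//.
exact: le_lt_trans (W_le _ _ mE mD (fun _ => id) ED) WD.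
Qed.

Let measurable_level (A : T -> bool) : measurable_fun D A -> measurable ([set x | A x] `&` D).
Proof.
by move=> mA; rewrite setIC; exact: (mA mD [set true]).
Qed.

Let measurable_level_fun (A : T -> bool) (c : R) : measurable_fun D A ->
  measurable_fun D (fun x => (c * (A x)%:R * v x)%:E).
Proof.
move=> mA; apply/measurable_EFinP; apply: measurable_funM => //.
apply: measurable_funM; first exact: measurable_cst.
rewrite (_ : (fun x => _) = fun x => if A x then 1 else 0 : R); last first.
  by apply/funext => x; case: (A x).
by apply: measurable_fun_if => //; exact: measurable_cst.
Qed.

Let integral_level (A : T -> bool) (c : R) : 0 <= c -> measurable_fun D A ->
  (\int[mu]_(x in D) (c * (A x)%:R * v x)%:E = c%:E * W ([set x | A x] `&` D))%E.
Proof.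
move=> c0 mA; have mAD := measurable_level _ mA; rewrite setIC in mAD *.
have mDA : measurable (D `\` [set x | A x]).
  rewrite (_ : D `\` _ = D `\` (D `&` [set x | A x])); first exact: measurableD.
  by rewrite setDIr setDv set0U.
rewrite -{1}(setUIDK D [set x | A x]) ge0_integral_setU//; last 3 first.
- by rewrite setUIDK; exact: measurable_level_fun.
- by move=> x _; rewrite lee_fin !mulr_ge0.
- by apply/disj_setPS => x [[_ ?] [_]].
rewrite [X in (_ + X)%E](_ : _ = 0%E); last first.
  rewrite integral0_eq// => x [_ /= /negP/negbTE ->].
  by rewrite mulr0 mul0r.
rewrite adde0 /W -ge0_integralZl_EFin//; last 2 first.
- by move=> x _; rewrite lee_fin.
- by apply/measurable_EFinP; apply: measurable_funS mv.
by apply: eq_integral => x /set_mem[_ /= ->]; rewrite mulr1 EFinM.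
Qed.

Let W_split E F : measurable E -> measurable F -> E `<=` D -> (W E <= W (E `&` F) + W (E `\` F))%E.
Proof.
move=> mE mF ED; rewrite -{1}(setUIDK E F) /W ge0_integral_setU//.
- exact: measurableI.
- exact: measurableD.
- by rewrite setUIDK; apply/measurable_EFinP; apply: measurable_funS mv.
- by move=> x _; rewrite lee_fin.
- by apply/disj_setPS => x [[_ ?] [_]].
Qed.

Let absorb_arith (K w A S S' eps : R) : 0 <= K -> (1 + 2 * K) * (A * w) <= eps ->
  S <= 2 * (A * w + K * S') -> A * w + K * S <= eps + 2 * K ^+ 2 * S'.
Proof. by move=> K0 tp /(ler_wpM2l K0); lra. Qed.

Lemma good_lambda_integral (N M : T -> R) (B p g e : R) :
  1 <= p -> 0 < g -> 0 <= e -> 2 `^ p * e <= 2^-1 ->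
  measurable_fun D N -> measurable_fun D M ->
  (forall x, 0 <= N x <= B) -> (forall x, 0 <= M x) ->
  (forall lam : R, 0 < lam ->
     (\int[mu]_(x in [set x | (2 * lam < N x)%R /\ (M x <= g * lam)%R] `&` D) (v x)%:E <=
      e%:E * \int[mu]_(x in [set x | (lam < N x)%R] `&` D) (v x)%:E)%E) ->
  (\int[mu]_(x in D) (N x `^ p * v x)%:E <=
   (4 * (2 `^ p) ^+ 2 * g^-1 `^ p)%:E * \int[mu]_(x in D) (M x `^ p * v x)%:E)%E.
Proof.
move=> p1 g0 e0 Ke mN mM N0 M0 gl.
have p_ge0 : 0 <= p by exact: le_trans p1.
have p_neq0 : p != 0 by rewrite gt_eqF// (lt_le_trans _ p1).
set IM := (\int[mu]_(x in D) (M x `^ p * v x)%:E)%E.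
pose w := fine (W D); have w0 : 0 <= w by rewrite fine_ge0.
have WDw : W D = w%:E by exact: W_fin.
apply/lee_addgt0Pr => eps eps0.
(* This collects the two error terms t^p w: one from the level sum, one from absorption. *)
pose K0 := 1 + 2 * 2 `^ p : R.
have K00 : 0 < K0 by rewrite ltr_pwDl// mulr_ge0// powR_ge0.
have Kw0 : 0 < K0 * (w + 1) by rewrite mulr_gt0// ltr_wpDl.
(* The lowest level makes the total error at most [eps]; w + 1 instead of [w] avoids a division by
   0. *)
pose t := (eps / (K0 * (w + 1))) `^ p^-1.
have t0 : 0 < t by rewrite powR_gt0// divr_gt0.
have tp : K0 * (t `^ p * w) <= eps.
  rewrite /t -powRrM mulVf// powRr1; last by rewrite divr_ge0// ltW.
  set q := eps / _; have q0 : 0 < q by rewrite divr_gt0.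
  have qE : q * (K0 * (w + 1)) = eps by rewrite divfK// gt_eqF.
  by rewrite -qE mulrCA ler_pM2l// ler_pM2l// lerDl.
have [m Bm] : exists m, B <= 2 ^+ m * t.
  exists (Num.bound (`|B| / t)); rewrite -ler_pdivrMr//.
  apply: (@le_trans _ _ (`|B| / t)); first by rewrite ler_pM2r ?invr_gt0// ler_norm.
  apply/ltW; apply: lt_trans (archi_boundP _) _; first by rewrite divr_ge0// ltW.
  by rewrite -natrX ltr_nat ltn_expl.
pose u i := 2 ^+ i * t; have u0 i : 0 < u i by rewrite mulr_gt0// exprn_gt0.
pose a i := u i `^ p; have a0 i : 0 <= a i by exact: powR_ge0.
have aS i : a i.+1 = 2 `^ p * a i.
  by rewrite /a /u exprS -mulrA powRM// ltW// u0.
have mNu i : measurable_fun D (fun x => u i < N x).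
  by apply: measurable_fun_ltr mN; exact: measurable_cst.
have mMu i : measurable_fun D (fun x => u i < g^-1 * M x).
  apply: measurable_fun_ltr; first exact: measurable_cst.
  by apply: measurable_funM mM; exact: measurable_cst.
have mvE : measurable_fun D (EFin \o v) by exact/measurable_EFinP.
have mpow (h : T -> R) : measurable_fun D h -> measurable_fun D (fun x => (h x `^ p * v x)%:E).
  move=> mh; apply/measurable_EFinP; apply: measurable_funM => //.
  exact: (measurableT_comp (measurable_powR p) mh).
have level_ge0 (b : bool) c x : 0 <= c -> (0 <= (c * b%:R * v x)%:E)%E.
  by move=> c0; rewrite lee_fin !mulr_ge0.
pose s i := fine (W ([set x | u i < N x] `&` D)).
pose r i := fine (W ([set x | u i < g^-1 * M x] `&` D)).
have sE i : W ([set x | u i < N x] `&` D) = (s i)%:E.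
  by apply: W_fin; [exact: measurable_level|exact: subIsetr].
have rE i : W ([set x | u i < g^-1 * M x] `&` D) = (r i)%:E.
  by apply: W_fin; [exact: measurable_level|exact: subIsetr].
have s0 i : 0 <= s i by rewrite fine_ge0.
have sw : s 0%N <= w.
  rewrite -lee_fin -sE -WDw.
  exact: (W_le _ _ (measurable_level _ (mNu 0%N)) mD (fun _ => id) (@subIsetr _ _ _)).
(* The set {N > u_(i+1)} is split by whether M > g u_i; since u_(i+1) = 2 u_i, the good-lambda
   hypothesis bounds the other part. *)
have sS i : s i.+1 <= e * s i + r i.
  rewrite -lee_fin EFinD EFinM -!sE -rE.
  pose F := [set x | u i < g^-1 * M x] `&` D.
  have mF : measurable F by exact: measurable_level.
  apply: le_trans (W_split _ F (measurable_level _ (mNu i.+1)) mF (@subIsetr _ _ _)) _.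
  rewrite [leLHS]addeC; apply: leeD; last first.
    apply: (W_le _ _ _ mF (@subIsetr _ _ _) (@subIsetr _ _ _)).
    by apply: measurableI mF; exact: measurable_level.
  apply: le_trans (gl _ (u0 i)).
  rewrite (_ : _ `\` _ = [set x | 2 * u i < N x /\ M x <= g * u i] `&` D)//.
  have E x : (u i < g^-1 * M x) = ~~ (M x <= g * u i).
    by rewrite -ltNge mulrC ltr_pdivlMr// mulrC.
  apply/seteqP; split => x /=.
    move=> [[Nx Dx] nF]; split => //; split; first by rewrite mulrA -exprS.
    by apply: contrapT => /negP; rewrite -E => ?; apply: nF.
  move=> [[Nx Mx] Dx]; split; first by split => //; rewrite /u exprS -mulrA.
  by move=> []; rewrite /= E Mx.
have absorb := level_sum_absorb a s r (2 `^ p) e w m (powR_ge0 _ _) Ke a0 s0 aS sw sS.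
have step1 : (\int[mu]_(x in D) (N x `^ p * v x)%:E <=
    (t `^ p * w + 2 `^ p * \sum_(i < m) a i * s i)%:E)%E.
  apply: (@le_trans _ _ (\int[mu]_(x in D) ((t `^ p)%:E * (v x)%:E +
    \sum_(i < m) (a i.+1 * (u i < N x)%R%:R * v x)%:E))%E).
    apply: ge0_le_integral => //.
    - by move=> x _; rewrite lee_fin mulr_ge0// powR_ge0.
    - exact: mpow.
    - apply: emeasurable_funD; first exact: measurable_funeM.
      by apply: emeasurable_sum => i; exact: measurable_level_fun.
    - move=> x _; have /andP[Nx NB] := N0 x.
      rewrite sumEFin -EFinM -EFinD lee_fin -mulr_suml -mulrDl ler_wpM2r//.
      exact: (powR_le_level_sum _ _ _ _ p_ge0 t0 Nx (le_trans NB Bm)).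
  rewrite ge0_integralD//; last 4 first.
  - by move=> x _; rewrite -EFinM lee_fin mulr_ge0// powR_ge0.
  - exact: measurable_funeM.
  - by move=> x _; apply: sume_ge0 => i _; exact: (level_ge0 _ _ _ (a0 _)).
  - by apply: emeasurable_sum => i; exact: measurable_level_fun.
  rewrite ge0_integralZl_EFin ?powR_ge0//; last by move=> x _; rewrite lee_fin.
  rewrite -/(W D) WDw -EFinM EFinD leeD2l// ge0_integral_sum//; last 2 first.
  - by move=> i; exact: measurable_level_fun.
  - by move=> i x _; exact: (level_ge0 _ _ _ (a0 _)).
  rewrite mulr_sumr -sumEFin; apply: lee_sum => i _.
  by rewrite (integral_level _ _ (a0 _))// sE aS mulrA EFinM.
have step2 : ((\sum_(i < m) a i * r i)%:E <= (2 * g^-1 `^ p)%:E * IM)%E.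
  have -> : (\sum_(i < m) a i * r i)%:E = (\int[mu]_(x in D)
     \sum_(i < m) (a i * (u i < g^-1 * M x)%R%:R * v x)%:E)%E.
    rewrite ge0_integral_sum//; last 2 first.
    - by move=> i; exact: measurable_level_fun.
    - by move=> i x _; exact: (level_ge0 _ _ _ (a0 _)).
    by rewrite -sumEFin; apply: eq_bigr => i _; rewrite (integral_level _ _ (a0 _))// rE EFinM.
  rewrite /IM -ge0_integralZl_EFin//; last 3 first.
  - by move=> x _; rewrite lee_fin mulr_ge0// powR_ge0.
  - exact: mpow.
  - by rewrite mulr_ge0// powR_ge0.
  apply: ge0_le_integral => //.
  - by move=> x _; apply: sume_ge0 => i _; exact: (level_ge0 _ _ _ (a0 _)).
  - by apply: emeasurable_sum => i; exact: measurable_level_fun.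
  - by apply: measurable_funeM; exact: mpow.
  - move=> x _; rewrite sumEFin -EFinM lee_fin -mulr_suml mulrA ler_wpM2r//.
    rewrite -mulrA -powRM ?invr_ge0 ?(ltW g0)//.
    by apply: level_sum_le_powR => //; rewrite mulr_ge0// invr_ge0 ltW.
apply: (le_trans step1); rewrite addeC.
apply: (@le_trans _ _ (eps + 2 * (2 `^ p) ^+ 2 * \sum_(i < m) a i * r i)%:E).
  rewrite (_ : a 0%N = t `^ p) in absorb; last by rewrite /a /u expr0 mul1r.
  by rewrite lee_fin; exact: (absorb_arith _ _ _ _ _ _ (powR_ge0 _ _) tp absorb).
rewrite EFinD leeD2l// EFinM.
rewrite (_ : 4 * _ * _ = 2 * (2 `^ p) ^+ 2 * (2 * g^-1 `^ p)); last by ring.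
rewrite [in leRHS]EFinM -muleA lee_wpmul2l// lee_fin mulr_ge0// exprn_ge0// powR_ge0.
Qed.

End good_lambda_integral.

(** * The dyadic sharp maximal function *)

Section sharp_maximal.
Context {R : realType} {n : nat}.
Local Notation Rn := 'rV[R]_n.+1.
Local Notation X := (Rspace R n).
Implicit Types (a b : Rn) (l r : R) (f v w : X -> R) (Q : set X).
Local Notation vol Q := (fine (leb (Q : set X))).
Hint Resolve measurable_cube : core.

Lemma dyadic_cube a l Q : 0 < l -> dyadic (cube a l : set X) Q ->
  exists b r, 0 < r /\ Q = cube b r.
Proof.
move=> l0; case=> [|b r e r0 _]; first by exists a, l.
by exists (b + \row_i (if e i then r / 2 else 0)), (r / 2); rewrite divr_gt0.
Qed.

(** Each corner lies in the other half-open cube, so the corners agree; a larger edge would then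
    admit a point that the smaller cube excludes. *)
Lemma cube_inj a b l r : 0 < l -> 0 < r -> cube a l = cube b r -> a = b /\ l = r.
Proof.
move=> l0 r0 ab.
have ba : cube b r a by rewrite -ab => i; rewrite !mxE lexx/= ltrDl.
have ab' : cube a l b by rewrite ab => i; rewrite !mxE lexx/= ltrDl.
have E : a = b.
  apply/rowP => i; apply/eqP; rewrite eq_le.
  by have := ba i; have := ab' i; rewrite !ord1 => /andP[-> _] /andP[-> _].
split=> //; subst b.
have le s t : 0 < s -> 0 < t -> cube a s = cube a t -> s <= t.
  move=> s0 t0 st; rewrite leNgt; apply/negP => ts.
  have : cube a s (a + const_mx t).
    by move=> i; rewrite !mxE lerDl ltW//= ltrD2l.
  by rewrite st => /(_ ord0); rewrite !mxE ltxx andbF.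
by apply/eqP; rewrite eq_le !le.
Qed.

(** The recursion of [gencube] bisects at the root, while [dyadic] bisects last; this unfolds
    [gencube] at the bottom to match. *)
Lemma gencubeSr k a l x : 0 < l -> exists b r,
  [/\ 0 < r, gencube k a l x = cube b r & gencube k.+1 a l x = cube (kid b r x) (r / 2)].
Proof.
elim: k a l => [|k IH] a l l0; first by exists a, l.
by have [|b [r [r0 E1 E2]]] := IH (kid a l x) (l / 2); [rewrite divr_gt0|exists b, r].
Qed.

Lemma dyadic_gencube a l Q : 0 < l -> dyadic (cube a l : set X) Q ->
  exists k, forall x, Q x -> Q = gencube k a l x.
Proof.
move=> l0; elim=> [|b r e r0 dP [k IH]]; first by exists 0%N.
exists k.+1 => x xe.
pose e' := finfun e.
have E : b + \row_i (if e i then r / 2 else 0) = child b r e'.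
  by congr (_ + _); apply/rowP => i; rewrite !mxE ffunE.
rewrite E in xe *.
have xP : cube b r x by exact: child_sub xe.
have [b' [r' [r'0 E1 E2]]] := gencubeSr k a l x l0.
have [bb rr] : b' = b /\ r' = r by apply: cube_inj => //; rewrite -E1 -IH.
by rewrite E2 bb rr (kid_child _ _ _ _ xe).
Qed.

(** Every dyadic cube containing [x] is a generation cube of [x], and each tree maximum is attained
    at a dyadic cube containing [x]. The supremum thus becomes that of a sequence of measurable
    functions. *)
Lemma dyadic_sharp_maximalE a l f x : 0 < l ->
  (forall Q, dyadic (cube a l) Q -> 0 < vol Q) ->
  leb.-integrable (cube a l : set X) (EFin \o f) -> cube a l x ->
  dyadic_sharp_maximal (cube a l) f x =
    ereal_sup (range (fun j => (tmax (osc f) j a l x)%:E)).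
Proof.
move=> l0 vpos If xa.
have oscE Q : dyadic (cube a l : set X) Q ->
    ((leb Q)^-1 * \int[leb]_(y in Q) `|f y - avg f Q|%:E)%E = (osc f Q)%:E.
  move=> dQ; have [b [r [r0 QE]]] := dyadic_cube _ _ _ l0 dQ.
  have vQ := vpos _ dQ.
  have IfQ : leb.-integrable (Q : set X) (EFin \o f).
    by rewrite QE; apply: integrableS If; [exact: measurable_cube..|rewrite -QE; exact: dyadic_sub].
  rewrite QE in IfQ vQ *.
  rewrite /osc EFinM /Rintegral fineK; last first.
    by apply: integrable_fin_num => //; exact: integrable_normc.
  by rewrite leb_cubeE inver gt_eqF.
apply/eqP; rewrite eq_le; apply/andP; split.
  apply: ge_ereal_sup => _ [Q [dQ Qx] <-]; rewrite oscE//.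
  have [k QE] := dyadic_gencube _ _ _ l0 dQ.
  apply: (@le_trans _ _ (tmax (osc f) k a l x)%:E).
    by rewrite lee_fin (QE x Qx); exact: le_tmax_gencube.
  by apply: ereal_sup_ubound; exists k.
apply: ge_ereal_sup => _ [j _ <-].
have sub b r : dyadic (cube a l : set X) (cube b r) -> cube b r x ->
    ((osc f (cube b r))%:E <= dyadic_sharp_maximal (cube a l) f x)%E.
  by move=> dP xb; apply: ereal_sup_ubound; exists (cube b r) => //; exact: oscE.
have gen b r : 0 < r -> dyadic (cube a l : set X) (cube b r) -> cube b r x ->
    ((tmax (osc f) j b r x)%:E <= dyadic_sharp_maximal (cube a l) f x)%E.
  elim: j b r => [|j IH] b r r0 dP xb; first exact: sub.
  rewrite /= EFin_max ge_max sub//=; apply: IH; first by rewrite divr_gt0.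
    exact: dyadic_child.
  exact: mem_kid.
by apply: gen => //; exact: dyadic_self.
Qed.

Lemma measurable_dyadic_sharp_maximal a l f : 0 < l ->
  (forall Q, dyadic (cube a l) Q -> 0 < vol Q) ->
  leb.-integrable (cube a l : set X) (EFin \o f) ->
  measurable_fun (cube a l : set X) (dyadic_sharp_maximal (cube a l) f).
Proof.
move=> l0 vpos If.
apply: (eq_measurable_fun (fun x : X => esups (fun j => (tmax (osc f) j a l x)%:E) 0%N)).
  move=> x /set_mem xa; rewrite dyadic_sharp_maximalE//; congr ereal_sup.
  by apply/seteqP; split => _ [j _ <-]; exists j.
by apply: measurable_fun_esups => j; apply/measurable_EFinP; exact: measurable_tmax.
Qed.

(** The positive part agrees with [w] almost everywhere in the cube, so all weighted measures are
    unchanged, and it is nonnegative everywhere. *)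
Lemma Ainfty_dyadic_weight a l w Cw dw : 0 < l ->
  Ainfty_dyadic (cube a l) w Cw dw ->
  dyadic_weight a l (fun x => Num.max (w x) 0) Cw dw.
Proof.
move=> l0 [[mw _ wpos] Cw0 dw0 A].
have mv : measurable_fun (cube a l : set X) (fun x => Num.max (w x) 0).
  by apply: measurable_maxr => //; exact: measurable_cst.
have wE (E : set X) : measurable E -> E `<=` cube a l ->
    weight_of (fun x => Num.max (w x) 0) E = weight_of w E.
  move=> mE EP; apply: ae_eq_integral.
  - exact: mE.
  - by apply/measurable_EFinP; apply: measurable_funS mv.
  - by apply/measurable_EFinP; apply: measurable_funS mw.
  - apply: filterS wpos => x wx Ex; congr EFin.
    by apply/max_idPl; exact/ltW/wx/EP.
split => //; first by move=> x; rewrite le_max lexx orbT.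
move=> Q dQ; have [b [r [r0 QE]]] := dyadic_cube _ _ _ l0 dQ.
have QP := dyadic_sub _ _ _ dQ; have [/andP[WQ0 WQ1] AQ] := A Q dQ.
have mQ : measurable Q by rewrite QE.
have lebQ : leb Q = (vol Q)%:E by rewrite QE leb_cubeE.
(* A cube of measure 0 would have weight 0, against w(Q) > 0. *)
have vQ : 0 < vol Q.
  rewrite lt_neqAle vol_ge0 andbT; apply/eqP => vQ.
  move: WQ0; rewrite /weight_of null_set_integral ?ltxx; [by []|exact: mQ| |by rewrite lebQ -vQ].
  by apply/measurable_EFinP; apply: measurable_funS mw.
split => //; first by rewrite wE.
move=> E s mE EQ s0 Es; have EP := subset_trans EQ QP.
rewrite !wE//.
have lebE : leb E = (vol E)%:E.
  rewrite fineK// ge0_fin_numE//; apply: (@le_lt_trans _ _ (leb Q)).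
    exact: (le_outer_measure lebesgue_outer_measure).
  by rewrite lebQ ltry.
have WQfin : weight_of w Q \is a fin_num by rewrite ge0_fin_numE// ltW.
have := AQ E mE EQ.
rewrite lebE lebQ -(fineK WQfin); rewrite -(fineK WQfin) lte_fin in WQ0.
move: (fine _) WQ0 => q q0.
rewrite !inver (gt_eqF q0) (gt_eqF vQ).
rewrite [X in (Cw%:E * X)%E](_ : _ = ((vol E / vol Q) `^ dw)%:E); last by rewrite -poweR_EFin EFinM.
rewrite -EFinM => H.
have {}H : (weight_of w E * q^-1%:E <= (Cw * s `^ dw)%:E)%E.
  apply: (le_trans H); rewrite lee_fin; apply: ler_wpM2l; first exact: ltW.
  apply: ge0_ler_powR; rewrite ?nnegrE.
  - exact: ltW.
  - by rewrite divr_ge0 ?vol_ge0.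
  - exact: s0.
  - by rewrite ler_pdivrMr.
by rewrite lee_pdivrMr in H.
Qed.

End sharp_maximal.

(** * The weighted norm inequality for the sharp maximal function *)

Section fefferman_stein.
Context {R : realType} {n : nat}.
Local Notation X := (Rspace R n).
Local Notation dirs := {ffun 'I_n.+1 -> bool}.
Hint Resolve measurable_cube : core.

Lemma dyadic_weight_sharp_maximal (p Cw dw g : R) a l (v f : X -> R) :
  1 <= p -> 0 <= Cw -> 0 < g -> 0 < l ->
  #|dirs|%:R * g <= 2^-1 -> 2 `^ p * (Cw * (2 * g) `^ dw) <= 2^-1 ->
  dyadic_weight a l v Cw dw -> leb.-integrable (cube a l : set X) (EFin \o f) ->
  (\int[leb]_(x in cube a l) (`|f x - avg f (cube a l)| `^ p * v x)%:E <=
   (4 * (2 `^ p) ^+ 2 * g^-1 `^ p)%:E * \int[leb]_(x in cube a l)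
         (dyadic_sharp_maximal (cube a l) f x `^ p * (v x)%:E))%E.
Proof.
move=> p1 Cw0 g0 l0 Kg Kp dv If; have [v0 mv Hv] := dv.
have p0 : 0 < p by exact: lt_le_trans p1.
have dP : dyadic (cube a l : set X) (cube a l) by exact: dyadic_self.
have vpos (Q : set X) (dQ : dyadic (cube a l : set X) Q) : 0 < fine (leb Q) by have [] := Hv Q dQ.
set c := avg f (cube a l); pose Nt j := tmax (fun Q => `|avg f Q - c|) j a l.
have N0 j x : 0 <= Nt j x by apply: le_trans (tmax_root _ _ _ _ _); exact: normr_ge0.
have mpow (h : X -> R) : measurable_fun (cube a l : set X) h ->
    measurable_fun (cube a l : set X) (fun x => (h x `^ p * v x)%:E).
  move=> mh; apply/measurable_EFinP; apply: measurable_funM mv.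
  exact: (measurableT_comp (measurable_powR p) mh).
have mN j : measurable_fun (cube a l : set X) (fun x => (Nt j x `^ p * v x)%:E).
  by apply: mpow; exact: measurable_tmax.
have mono_pow (y z : R) : 0 <= y -> y <= z -> y `^ p <= z `^ p.
  move=> y0 yz; have z0 := le_trans y0 yz.
  by apply: ge0_ler_powR; rewrite ?nnegrE// ltW.
set RHS := (X in (_ <= X)%E).
have bound j : (\int[leb]_(x in cube a l) (Nt j x `^ p * v x)%:E <= RHS)%E.
  have [B NB] := tmax_bounded (fun Q => `|avg f Q - c|) j a l.
  have osc0 x : 0 <= tmax (osc f) j a l x.
    apply: le_trans (tmax_root _ _ _ _ _).
    by rewrite mulr_ge0 ?invr_ge0 ?vol_ge0// Rintegral_ge0.
  apply: le_trans (@good_lambda_integral _ _ _ leb (cube a l) v _ v0 mv _ (Nt j)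
    (tmax (osc f) j a l) B p g (Cw * (2 * g) `^ dw) p1 g0 _ Kp _ _ _ osc0 _) _ => //.
  - by have [] := Hv _ dP.
  - by rewrite mulr_ge0// powR_ge0.
  - exact: measurable_tmax.
  - exact: measurable_tmax.
  - by move=> x; rewrite N0 NB.
  (* At the root the average is [c] itself, so the invariant holds for every [lam]. *)
  - move=> lam lam0; apply: (good_lambda_tmax f v c g Cw dw a l lam j a l) => //.
    by rewrite subrr normr0 ltW.
  apply: lee_wpmul2l; first by rewrite lee_fin !mulr_ge0 ?powR_ge0// exprn_ge0// powR_ge0.
  apply: ge0_le_integral.
  - exact: measurable_cube.
  - by move=> x _; rewrite lee_fin mulr_ge0// powR_ge0.
  - by apply: mpow; exact: measurable_tmax.
  - apply: emeasurable_funM; last exact/measurable_EFinP.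
    apply: (measurableT_comp (measurable_poweR p)).
    exact: measurable_dyadic_sharp_maximal.
  - move=> x xa; rewrite EFinM; apply: lee_wpmul2r; first by rewrite lee_fin.
    rewrite -poweR_EFin; apply: gt0_ler_poweR; first exact: ltW.
    + by rewrite in_itv/= leey lee_fin osc0.
    + rewrite in_itv/= leey andbT dyadic_sharp_maximalE//.
      apply: (@le_trans _ _ (tmax (osc f) j a l x)%:E); first by rewrite lee_fin osc0.
      by apply: ereal_sup_ubound; exists j.
    + by rewrite dyadic_sharp_maximalE//; apply: ereal_sup_ubound; exists j.
have ndN x : cube a l x -> {homo (fun j => (Nt j x `^ p * v x)%:E) : i j / (i <= j)%N >-> (i <= j)%E}.
  by move=> _ i j ij; rewrite lee_fin ler_wpM2r// mono_pow// tmax_homo.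
have N0v j x : cube a l x -> (0 <= (Nt j x `^ p * v x)%:E)%E.
  by move=> _; rewrite lee_fin mulr_ge0// powR_ge0.
have cvgN := cvg_monotone_convergence (mu := leb) (measurable_cube a l) mN N0v ndN.
apply: (@le_trans _ _ (\int[leb]_(x in cube a l) limn (fun j => (Nt j x `^ p * v x)%:E))%E); last first.
  rewrite -(cvg_lim _ cvgN)//; apply: lime_le; first by apply/cvg_ex; eexists; exact: cvgN.
  by near=> j; exact: bound.
have limE x : cube a l x -> limn (fun j => (Nt j x `^ p * v x)%:E) =
    ereal_sup (range (fun j => (Nt j x `^ p * v x)%:E)).
  by move=> xa; apply/cvg_lim => //; exact: ereal_nondecreasing_cvgn (ndN x xa).
have mf : measurable_fun (cube a l : set X) (fun x => `|f x - c|).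
  by have := integrable_normc _ c _ _ If => /measurable_int/measurable_EFinP.
apply: ae_ge0_le_integral.
- exact: measurable_cube.
- by move=> x _; rewrite lee_fin mulr_ge0// powR_ge0.
- exact: mpow.
- move=> x xa; rewrite limE//; apply: le_trans (N0v 0%N x xa) _.
  by apply: ereal_sup_ubound; exists 0%N.
- apply: (eq_measurable_fun (fun x : X => esups (fun j => (Nt j x `^ p * v x)%:E) 0%N)).
    move=> x /set_mem xa; rewrite limE//; congr ereal_sup.
    by apply/seteqP; split => _ [j _ <-]; exists j.
  by apply: measurable_fun_esups => j; exact: mN.
(* If y^p v(x) exceeded the supremum, that supremum would be a real s and v(x) > 0. Then (s /
   v(x))^(1/p) < y, and [ae_tmax] yields a tree maximum above this threshold, whose term exceeds
   s. *)
apply: filterS (ae_tmax f c a l l0 If) => x fx xa; rewrite limE//.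
set y := `|f x - c|; rewrite leNgt; apply/negP.
set S := ereal_sup _ => Sy.
have leS j : ((Nt j x `^ p * v x)%:E <= S)%E by apply: ereal_sup_ubound; exists j.
have S0 : (0 <= S)%E by exact: le_trans (N0v 0%N x xa) (leS 0%N).
have Sfin : S \is a fin_num by rewrite ge0_fin_numE// (lt_trans Sy)// ltry.
rewrite -(fineK Sfin) in leS S0 Sy.
move: (fine S) leS S0 Sy => s leS; rewrite !lte_fin lee_fin => s0 sy.
have vx : 0 < v x.
  rewrite lt_neqAle v0 andbT; apply/eqP => vx.
  by move: sy; rewrite -vx mulr0 ltNge s0.
have : (s / v x) `^ p^-1 < y.
  rewrite ltNge; apply/negP => ys; move: sy; rewrite ltNge => /negP; apply.
  have := mono_pow _ _ (normr_ge0 _) ys.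
  rewrite -powRrM mulVf ?gt_eqF// powRr1; last by rewrite divr_ge0// ltW.
  by rewrite ler_pdivlMr.
move=> /(fx xa)[j sj]; have := leS j; rewrite lee_fin leNgt => /negP; apply.
rewrite -ltr_pdivrMr//.
have := @gt0_ltr_powR R p p0 ((s / v x) `^ p^-1) (Nt j x).
rewrite -powRrM mulVf ?gt_eqF// powRr1; last by rewrite divr_ge0// ltW.
by apply; rewrite ?nnegrE ?powR_ge0.
Unshelve. all: by end_near. Qed.
End fefferman_stein.

Theorem theorem4p2 (R : realType) (n : nat) (p Cw dw : R) :
  1 < p -> 0 < Cw -> 0 < dw ->
  exists C : R, 0 < C /\
    forall (Q0 : set (Rspace R n)) (w f : Rspace R n -> R),
      is_cube Q0 -> Ainfty_dyadic Q0 w Cw dw ->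
      leb.-integrable Q0 (EFin \o f) ->
      (\int[leb]_(x in Q0) (`|f x - avg f Q0| `^ p * w x)%:E <=
       C%:E * \int[leb]_(x in Q0)
         (dyadic_sharp_maximal Q0 f x `^ p * (w x)%:E))%E.
Proof.
move=> p1 Cw0 dw0.
pose K : R := #|{ffun 'I_n.+1 -> bool}|%:R.
have K0 : 0 < K by rewrite ltr0n; apply/card_gt0P; exists (finfun (fun=> true)).
pose q : R := 2^-1 / (2 `^ p * Cw).
have pC : 0 < 2 `^ p * Cw by rewrite mulr_gt0// powR_gt0.
have q0 : 0 < q by rewrite divr_gt0// invr_gt0.
(* The first bound keeps the jump between parent and child below lam / 2; the second makes (2 g)^dw
   at most [q], which is what absorption requires. *)
pose g : R := Num.min (2^-1 / K) (2^-1 * q `^ dw^-1).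
have g0 : 0 < g by rewrite lt_min divr_gt0 ?invr_gt0//= mulr_gt0 ?invr_gt0// powR_gt0.
have Kg : K * g <= 2^-1 by rewrite mulrC -ler_pdivlMr// ge_min lexx.
have Kp : 2 `^ p * (Cw * (2 * g) `^ dw) <= 2^-1.
  rewrite mulrA mulrC -ler_pdivlMr// -/q.
  have -> : q = (q `^ dw^-1) `^ dw by rewrite -powRrM mulVf ?gt_eqF// powRr1// ltW.
  apply: ge0_ler_powR; rewrite ?nnegrE ?powR_ge0//; [exact: ltW|by rewrite mulr_ge0// ltW|].
  by rewrite mulrC -ler_pdivlMr// ge_min [_ `^ _ / _]mulrC lexx orbT.
exists (4 * (2 `^ p) ^+ 2 * g^-1 `^ p); split.
  by rewrite !mulr_gt0// ?exprn_gt0 ?powR_gt0// invr_gt0.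
move=> _ w f [a [l [l0 ->]]] A If.
have dv := Ainfty_dyadic_weight _ _ _ _ _ l0 A; have [v0 mv Hv] := dv.
have [[mw _ wpos] _ _ _] := A.
have vpos (Q : set (Rspace R n)) (dQ : dyadic (cube a l : set (Rspace R n)) Q) :
  0 < fine (leb Q) by have [] := Hv Q dQ.
have mQ : measurable (cube a l : set (Rspace R n)) by exact: measurable_cube.
have wv : {ae leb, forall x, cube a l x -> w x = Num.max (w x) 0}.
  by apply: filterS wpos => x wx xa; apply/esym/max_idPl; exact/ltW/wx.
have mf : measurable_fun (cube a l : set (Rspace R n)) (fun x => `|f x - avg f (cube a l)| `^ p).
  apply: (measurableT_comp (measurable_powR p)).
  by have := integrable_normc _ (avg f (cube a l)) _ _ If => /measurable_int/measurable_EFinP.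
have mM : measurable_fun (cube a l : set (Rspace R n))
    (fun x => dyadic_sharp_maximal (cube a l) f x `^ p)%E.
  apply: (measurableT_comp (measurable_poweR p)).
  exact: measurable_dyadic_sharp_maximal.
(* The inequality is obtained for the positive part of [w]; both integrals are then transferred to
   [w] by almost everywhere equality. *)
have := dyadic_weight_sharp_maximal _ _ _ _ _ _ _ _ (ltW p1) (ltW Cw0) g0 l0 Kg Kp dv If.
congr (_ <= _ * _)%E; apply: ae_eq_integral.
- exact: mQ.
- by apply/measurable_EFinP; exact: (measurable_funM mf mv).
- by apply/measurable_EFinP; exact: (measurable_funM mf mw).
- by apply: filterS wv => x wx xa; rewrite -wx.
- exact: mQ.
- by apply: emeasurable_funM; [exact: mM|exact/measurable_EFinP].
- by apply: emeasurable_funM; [exact: mM|exact/measurable_EFinP].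
- by apply: filterS wv => x wx xa; rewrite -wx.
Qed.
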